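(* Let $s\in I$ and $T>s$. Then there exist positive constants $C_1,C_2$, depending on $s$ and $T$, such that: (i) for every $f\in C^1_b(\mathbb{R}^d)$, $$\|\nabla G(t,s)f\|_\infty\le C_1\|f\|_{C^1_b(\mathbb{R}^d)},\qquad s<t\le T;$$ (ii) for every $f\in C_b(\mathbb{R}^d)$, $$\|\nabla G(t,s)f\|_\infty\le\frac{C_2}{\sqrt{t-s}}\|f\|_\infty,\qquad s<t\le T.$$
   Context: $d\ge 1$ is an integer and $I\subset\mathbb{R}$ is an interval which is either $\mathbb{R}$ or a right halfline. For $t\in I$ and smooth $\varphi:\mathbb{R}^d\to\mathbb{R}$, $$(\mathcal{A}(t)\varphi)(x)=\sum_{i,j=1}^d q_{ij}(t,x)D_{ij}\varphi(x)+\sum_{i=1}^d b_i(t,x)D_i\varphi(x),$$ with $Q=(q_{ij})$, $b=(b_i)$. $C^{\alpha/2,\alpha}_{\rm loc}(I\times\mathbb{R}^d)$ is the set of functions that are $\alpha$-Hölder continuous with respect to the parabolic distance on every compact subset of $I\times\mathbb{R}^d$. Standing assumptions, for some $\alpha\in(0,1)$: (1) all $q_{ij},b_i$ and their first-order spatial derivatives belong to $C^{\alpha/2,\alpha}_{\rm loc}(I\times\mathbb{R}^d)$; (2) for every $(t,x)\in I\times\mathbb{R}^d$ the matrix $Q(t,x)$ is symmetric, and there is a function $\eta:I\times\mathbb{R}^d\to\mathbb{R}$ with $0<\eta_0:=\inf_{I\times\mathbb{R}^d}\eta$ and $\langle Q(t,x)\xi,\xi\rangle\ge\eta(t,x)|\xi|^2$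 for all $\xi\in\mathbb{R}^d$, $(t,x)\in I\times\mathbb{R}^d$; (3) for every bounded interval $J\subset I$ there exist $\varphi=\varphi_J\in C^2(\mathbb{R}^d)$ and $\lambda=\lambda_J>0$ such that $\lim_{|x|\to+\infty}\varphi(x)=+\infty$ and $(\mathcal{A}(t)\varphi)(x)-\lambda\varphi(x)\le0$ for $(t,x)\in J\times\mathbb{R}^d$; (4) there is a continuous $k:I\to\mathbb{R}$ such that $\langle\nabla_xb(t,x)\xi,\xi\rangle\le k(t)|\xi|^2$ for all $\xi\in\mathbb{R}^d$, $(t,x)\in I\times\mathbb{R}^d$ ($\nabla_xb$ is the Jacobian matrix in $x$); (5) there is a continuous $\rho:I\to[0,+\infty)$ such that $|D_kq_{ij}(t,x)|\le\rho(t)\eta(t,x)$ for all $i,j,k\in\{1,\dots,d\}$, $(t,x)\in I\times\mathbb{R}^d$. Under these assumptions, for every $s\in I$ and $f\in C_b(\mathbb{R}^d)$ (bounded continuous functions, sup-norm $\|\cdot\|_\infty$) there is a unique bounded classical solution $u_f\in C_b([s,+\infty)\times\mathbb{R}^d)\cap C^{1,2}((s,+\infty)\times\mathbb{R}^d)$ of $u_t=\mathcal{A}(t)u$ in $(s,+\infty)\times\mathbb{R}^d$, $u(s,\cdot)=f$; for $t>s$, $(G(t,s)f)(x)=u_f(t,x)$, and $G(t,t)=\mathrm{id}$. $C^1_b(\mathbb{R}^d)$ is the space of bounded $C^1$ functions with bounded first derivatives, $\|f\|_{C^1_b(\mathbb{R}^d)}=\|f\|_\infty+\sum_{i=1}^d\|D_if\|_\infty$;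 $\|\nabla f\|_\infty=\sup_x|\nabla f(x)|$ with the Euclidean norm. *)

(* Defs.v *)
From HB Require Import structures.
From mathcomp Require Export all_boot all_order all_algebra.
From mathcomp Require Export all_classical all_reals all_analysis.

Set Implicit Arguments.
Unset Strict Implicit.
Unset Printing Implicit Defensive.

Import Order.TTheory GRing.Theory Num.Theory.
Import numFieldNormedType.Exports.

Local Open Scope classical_set_scope.
Local Open Scope ring_scope.

(* The norm that the library puts on 'rV[R]_d is the maximum norm, hence the
   explicit Euclidean norm. It induces the same topology. *)
Definition enorm (R : realType) (d : nat) (v : 'rV[R]_d) : R :=
  Num.sqrt (\sum_(i < d) v 0 i ^+ 2).

(* <M xi, xi> *)
Definition quadform (R : realType) (d : nat) (M : 'M[R]_d) (xi : 'rV[R]_d) : R :=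
  (xi *m M *m xi^T) 0 0.

(* Vectors are rows, so delta_mx 0 i is the i-th vector of the canonical basis. *)
Definition partial (R : realType) (d : nat) (i : 'I_d) (f : 'rV[R]_d -> R)
    (x : 'rV[R]_d) : R :=
  'D_(delta_mx 0 i) f x.

Definition has_partial (R : realType) (d : nat) (i : 'I_d) (f : 'rV[R]_d -> R)
    (x : 'rV[R]_d) : Prop :=
  derivable f x (delta_mx 0 i).

Definition grad (R : realType) (d : nat) (f : 'rV[R]_d -> R) (x : 'rV[R]_d) :
    'rV[R]_d :=
  \row_i partial i f x.

Definition jacobian_mx (R : realType) (d : nat) (b : 'rV[R]_d -> 'rV[R]_d)
    (x : 'rV[R]_d) : 'M[R]_d :=
  \matrix_(i, j) partial j (fun y => b y 0 i) x.

Definition is_C1 (R : realType) (d : nat) (f : 'rV[R]_d -> R) : Prop :=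
  continuous f /\
  forall i, (forall x, has_partial i f x) /\ continuous (partial i f).

Definition is_C2 (R : realType) (d : nat) (f : 'rV[R]_d -> R) : Prop :=
  is_C1 f /\ forall i, is_C1 (partial i f).

Definition is_Cb (R : realType) (d : nat) (f : 'rV[R]_d -> R) : Prop :=
  continuous f /\ bounded_fun f.

Definition is_C1b (R : realType) (d : nat) (f : 'rV[R]_d -> R) : Prop :=
  [/\ is_C1 f, bounded_fun f & forall i, bounded_fun (partial i f)].

(* Suprema are taken in the extended reals: the real-valued sup of an unbounded
   set is 0. *)
Definition supnorm (R : realType) (d : nat) (f : 'rV[R]_d -> R) : \bar R :=
  ereal_sup (range (fun x => `|f x|%:E)).

Definition grad_supnorm (R : realType) (d : nat) (f : 'rV[R]_d -> R) : \bar R :=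
  ereal_sup (range (fun x => (enorm (grad f x))%:E)).

Definition C1b_norm (R : realType) (d : nat) (f : 'rV[R]_d -> R) : \bar R :=
  (supnorm f + \sum_(i < d) supnorm (partial i f))%E.

Definition full_or_right_halfline (R : realType) (I : set R) : Prop :=
  I = setT \/ exists a : R, I = `]a, +oo[%classic \/ I = `[a, +oo[%classic.

Definition parabolic_dist (R : realType) (d : nat) (p p' : R * 'rV[R]_d) : R :=
  enorm (p.2 - p'.2) + Num.sqrt `|p.1 - p'.1|.

Definition loc_parabolic_holder (R : realType) (d : nat) (I : set R) (alpha : R)
    (g : R -> 'rV[R]_d -> R) : Prop :=
  forall K : set (R * 'rV[R]_d), compact K -> K `<=` I `*` setT ->
  exists C : R, forall p p', K p -> K p' ->
    `|g p.1 p.2 - g p'.1 p'.2| <= C * parabolic_dist p p' `^ alpha.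

Definition holder_with_gradient (R : realType) (d : nat) (I : set R) (alpha : R)
    (g : R -> 'rV[R]_d -> R) : Prop :=
  loc_parabolic_holder I alpha g /\
  forall k, (forall t x, I t -> has_partial k (g t) x) /\
            loc_parabolic_holder I alpha (fun t => partial k (g t)).

Definition regular_coefficients (R : realType) (d : nat) (I : set R) (alpha : R)
    (Q : R -> 'rV[R]_d -> 'M[R]_d) (b : R -> 'rV[R]_d -> 'rV[R]_d) : Prop :=
  (forall i j, holder_with_gradient I alpha (fun t x => Q t x i j)) /\
  (forall i, holder_with_gradient I alpha (fun t x => b t x 0 i)).

Definition elliptic (R : realType) (d : nat) (I : set R)
    (Q : R -> 'rV[R]_d -> 'M[R]_d) (eta : R -> 'rV[R]_d -> R) : Prop :=
  [/\ forall t x, I t -> (Q t x)^T = Q t x,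
      (0 < ereal_inf [set (eta p.1 p.2)%:E | p in I `*` setT])%E &
      forall t x xi, I t -> eta t x * enorm xi ^+ 2 <= quadform (Q t x) xi].

(* (A(t) phi)(x) *)
Definition operatorA (R : realType) (d : nat)
    (Q : R -> 'rV[R]_d -> 'M[R]_d) (b : R -> 'rV[R]_d -> 'rV[R]_d)
    (t : R) (phi : 'rV[R]_d -> R) (x : 'rV[R]_d) : R :=
  \sum_(i < d) \sum_(j < d) Q t x i j * partial i (partial j phi) x +
  \sum_(i < d) b t x 0 i * partial i phi x.

Definition tends_to_pinfty (R : realType) (d : nat) (phi : 'rV[R]_d -> R) : Prop :=
  forall M : R, exists r : R, forall x, r <= enorm x -> M <= phi x.

Definition lyapunov (R : realType) (d : nat) (I : set R)
    (Q : R -> 'rV[R]_d -> 'M[R]_d) (b : R -> 'rV[R]_d -> 'rV[R]_d) : Prop :=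
  forall J : set R, is_interval J -> bounded_set J -> J `<=` I ->
  exists (phi : 'rV[R]_d -> R) (lambda : R),
    [/\ is_C2 phi, 0 < lambda, tends_to_pinfty phi &
        forall t x, J t -> operatorA Q b t phi x - lambda * phi x <= 0].

Definition drift_dissipative (R : realType) (d : nat) (I : set R)
    (b : R -> 'rV[R]_d -> 'rV[R]_d) : Prop :=
  exists k : R -> R, {within I, continuous k} /\
    forall t x xi, I t ->
      quadform (jacobian_mx (b t) x) xi <= k t * enorm xi ^+ 2.

Definition diffusion_gradient_bound (R : realType) (d : nat) (I : set R)
    (Q : R -> 'rV[R]_d -> 'M[R]_d) (eta : R -> 'rV[R]_d -> R) : Prop :=
  exists rho : R -> R,
    [/\ {within I, continuous rho}, forall t, I t -> 0 <= rho t &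
        forall i j k t x, I t ->
          `|partial k (fun y => Q t y i j) x| <= rho t * eta t x].

(* u belongs to C^{1,2}((s, +oo) x R^d). *)
Definition is_C12 (R : realType) (d : nat) (s : R) (u : R -> 'rV[R]_d -> R) : Prop :=
  let cont (g : R -> 'rV[R]_d -> R) :=
    {within `]s, +oo[%classic `*` setT, continuous (fun p => g p.1 p.2)} in
  [/\ cont u,
      (forall t x, s < t -> derivable (u^~ x) t 1) /\
        cont (fun t x => derive1 (u^~ x) t),
      forall i, (forall t x, s < t -> has_partial i (u t) x) /\
        cont (fun t => partial i (u t)) &
      forall i j,
        (forall t x, s < t -> has_partial i (partial j (u t)) x) /\
        cont (fun t => partial i (partial j (u t)))].

(* The values u t x for t < s are irrelevant. *)
Definition bounded_classical_solution (R : realType) (d : nat)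
    (Q : R -> 'rV[R]_d -> 'M[R]_d) (b : R -> 'rV[R]_d -> 'rV[R]_d)
    (s : R) (f : 'rV[R]_d -> R) (u : R -> 'rV[R]_d -> R) : Prop :=
  [/\ {within `[s, +oo[%classic `*` setT, continuous (fun p => u p.1 p.2)} /\
        [bounded u p.1 p.2 | p in `[s, +oo[%classic `*` setT],
      is_C12 s u,
      forall t x, s < t -> derive1 (u^~ x) t = operatorA Q b t (u t) x &
      forall x, u s x = f x].

(* G(t,s) f for s <= t. Under the standing assumptions the bounded classical
   solution exists and is unique on [s, +oo) x R^d when f is in C_b(R^d), so
   that the default value of xget is not used. *)
Definition evolG (R : realType) (d : nat)
    (Q : R -> 'rV[R]_d -> 'M[R]_d) (b : R -> 'rV[R]_d -> 'rV[R]_d)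
    (t s : R) (f : 'rV[R]_d -> R) : 'rV[R]_d -> R :=
  if t == s then f
  else xget (fun _ _ => 0) [set u | bounded_classical_solution Q b s f u] t.

(* Main.v *)
(** Doubling of variables in the style of Ishii and Lions. Let
    w(t,x,y) = u(t,x) - u(t,y) - psi(|x-y|) - c1 (tau-t), where
    psi(r) = 2 K delta r - K r^2 on r <= delta. If w, corrected by a small
    multiple of the Lyapunov function, had a positive maximum, it would be
    attained at some t0 > s and 0 < |x0-y0| < delta. Testing the Hessian of w
    there against the block matrix that couples the common part of Q(x0) and
    Q(y0) synchronously, except for a piece (m/2) e e^T along
    e = (x0-y0)/|x0-y0| which is reflected, brings in 4 (m/2) psi'' = -4 K m,
    where m >= eta_0 is a local upper bound of eta. Since
    |Q(x0)-Q(y0)| = O(m |x0-y0|) by (5) and the drift contributes at most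
    k |x0-y0| psi' by (4), this beats all other terms when delta is small.
    Hence |u(tau,x)-u(tau,y)| <= 2 K delta |x-y| for |x-y| <= delta, which bounds
    the gradient. For (i) take c1 = 0 and delta fixed; for (ii) take delta
    proportional to sqrt(tau-s) and c1 = 2 |f|/(tau-s), so that the initial
    inequality at t = s is trivial. Only C^{1,2} regularity of u is used, and no
    existence result: if there is no solution, evolG is 0. *)

From HB Require Import structures.
Require Import Defs.
From mathcomp Require Import ring lra.
Import Order.TTheory GRing.Theory Num.Theory.
Import numFieldNormedType.Exports.

Set Implicit Arguments.
Unset Strict Implicit.
Unset Printing Implicit Defensive.

Local Open Scope classical_set_scope.
Local Open Scope ring_scope.

(** * Quadratic forms *)

Section quadratic_forms.
Variables (R : realType) (d : nat).
Implicit Types (A B X : 'M[R]_d) (u v p xi : 'rV[R]_d).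

Definition dotrv u v : R := \sum_(i < d) u 0 i * v 0 i.

(** The trace pairing. The second-order part of the operator is its value at Q and the Hessian. *)
Definition frobenius A X : R := \sum_(i < d) \sum_(j < d) A i j * X i j.

Lemma enorm_ge0 u : 0 <= enorm u.
Proof. exact: sqrtr_ge0. Qed.

Lemma sqr_enorm u : enorm u ^+ 2 = dotrv u u.
Proof.
rewrite sqr_sqrtr; first by apply: eq_bigr => i _; rewrite expr2.
by apply: sumr_ge0 => i _; exact: sqr_ge0.
Qed.

Lemma ler_coord_enorm u i : `|u 0 i| <= enorm u.
Proof.
rewrite -[leLHS]ger0_norm// -sqrtr_sqr ler_sqrt ?sumr_ge0//; last first.
  by move=> k _; exact: sqr_ge0.
rewrite real_normK ?num_real// (bigD1 i)//= lerDl.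
by apply: sumr_ge0 => k _; exact: sqr_ge0.
Qed.

Lemma dotrvC u v : dotrv u v = dotrv v u.
Proof. by apply: eq_bigr => i _; rewrite mulrC. Qed.

Lemma dotrvDl u v w : dotrv (u + v) w = dotrv u w + dotrv v w.
Proof. by rewrite -big_split; apply: eq_bigr => i _; rewrite mxE mulrDl. Qed.

Lemma dotrvZl a u v : dotrv (a *: u) v = a * dotrv u v.
Proof. by rewrite mulr_sumr; apply: eq_bigr => i _; rewrite mxE mulrA. Qed.

Lemma dotrvDr u v w : dotrv w (u + v) = dotrv w u + dotrv w v.
Proof. by rewrite dotrvC dotrvDl !(dotrvC w). Qed.

Lemma dotrvZr a u v : dotrv u (a *: v) = a * dotrv u v.
Proof. by rewrite dotrvC dotrvZl dotrvC. Qed.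

Lemma dotrvBl u v w : dotrv (u - v) w = dotrv u w - dotrv v w.
Proof. by rewrite -[- v]scaleN1r dotrvDl dotrvZl mulN1r. Qed.

Lemma dotrv_delta u i : dotrv u (delta_mx 0 i) = u 0 i.
Proof.
rewrite /dotrv (bigD1 i)//= big1 ?addr0 => [|k ki]; rewrite mxE ?eqxx ?mulr1//.
by rewrite (negbTE ki) mulr0.
Qed.

Lemma enormZ a u : enorm (a *: u) = `|a| * enorm u.
Proof.
apply/eqP; rewrite -(eqrXn2 (n := 2))// ?mulr_ge0 ?enorm_ge0//.
by rewrite exprMn !sqr_enorm dotrvZl dotrvZr real_normK ?num_real// expr2 mulrA.
Qed.

Lemma enorm0 : enorm (0 : 'rV[R]_d) = 0.
Proof. by rewrite -(scale0r 0) enormZ normr0 mul0r. Qed.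

Lemma enormN u : enorm (- u) = enorm u.
Proof. by rewrite -scaleN1r enormZ normrN normr1 mul1r. Qed.

Lemma enorm_eq0 u : (enorm u == 0) = (u == 0).
Proof.
apply/eqP/eqP => [u0|->]; last exact: enorm0.
apply/rowP => i; apply/eqP; rewrite mxE -normr_le0 -u0.
exact: ler_coord_enorm.
Qed.

Lemma cauchy_schwarz u v : dotrv u v ^+ 2 <= enorm u ^+ 2 * enorm v ^+ 2.
Proof.
have [->|u0] := eqVneq u 0.
  by rewrite -(scale0r 0) dotrvZl mul0r expr0n mulr_ge0 ?sqr_ge0.
have nu : 0 < dotrv u u by rewrite -sqr_enorm exprn_gt0// lt_def enorm_eq0 u0 enorm_ge0.
have := sqr_ge0 (enorm (dotrv u u *: v - dotrv u v *: u)).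
rewrite !sqr_enorm -scaleNr !(dotrvDl, dotrvDr, dotrvZl, dotrvZr) (dotrvC v u).
move=> h.
rewrite -subr_ge0 -(pmulr_rge0 _ nu).
by apply: le_trans h _; lra.
Qed.

Lemma quadformE A xi :
  quadform A xi = \sum_(i < d) \sum_(j < d) A i j * (xi 0 i * xi 0 j).
Proof.
rewrite /quadform mxE exchange_big/=; apply: eq_bigr => j _.
rewrite !mxE mulr_suml; apply: eq_bigr => i _.
by rewrite -mulrA mulrCA.
Qed.

Lemma quadformD A B xi : quadform (A + B) xi = quadform A xi + quadform B xi.
Proof. by rewrite /quadform mulmxDr mulmxDl mxE. Qed.

Lemma quadformZ a A xi : quadform (a *: A) xi = a * quadform A xi.
Proof. by rewrite /quadform -scalemxAr -scalemxAl mxE. Qed.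

Lemma quadformN A xi : quadform (- A) xi = - quadform A xi.
Proof. by rewrite -scaleN1r quadformZ mulN1r. Qed.

Lemma quadformB A B xi : quadform (A - B) xi = quadform A xi - quadform B xi.
Proof. by rewrite quadformD quadformN. Qed.

Lemma quadform_opp A xi : quadform A (- xi) = quadform A xi.
Proof. by rewrite /quadform linearN/= !mulNmx mulmxN opprK. Qed.

Lemma quadform_scalar a xi : quadform a%:M xi = a * enorm xi ^+ 2.
Proof.
by rewrite /quadform mul_mx_scalar -scalemxAl mxE sqr_enorm mxE /dotrv;
  congr (_ * _); apply: eq_bigr => i _; rewrite mxE.
Qed.

Lemma quadform_rank1 p xi : quadform (p^T *m p) xi = dotrv p xi ^+ 2.
Proof.
rewrite /quadform mulmxA -mulmxA mxE big_ord1 expr2 !mxE.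
by congr (_ * _); apply: eq_bigr => i _; rewrite mxE// mulrC.
Qed.

Lemma quadform_delta A i : quadform A (delta_mx 0 i) = A i i.
Proof.
by rewrite /quadform -rowE mxE (bigD1 i)//= big1 ?addr0 => [|k ki];
  rewrite !mxE ?eqxx ?mulr1// (negbTE ki) mulr0.
Qed.

Lemma quadform_lin A xi v a : A^T = A ->
  quadform A (xi + a *: v) =
  quadform A xi + 2 * a * (xi *m A *m v^T) 0 0 + a ^+ 2 * quadform A v.
Proof.
move=> symA; rewrite /quadform linearD/= linearZ/= !mulmxDl !mulmxDr.
rewrite -!scalemxAl -!scalemxAr -?scalemxAl.
have <- : (v *m A *m xi^T) 0 0 = (xi *m A *m v^T) 0 0.
  have -> : v *m A *m xi^T = (xi *m A *m v^T)^T.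
    by rewrite !trmx_mul trmxK symA mulmxA.
  by rewrite mxE.
have <- : (v *m A *m xi^T)^T = xi *m A *m v^T.
  by rewrite !trmx_mul trmxK symA mulmxA.
move: (v *m A *m xi^T) (xi *m A *m xi^T) (v *m A *m v^T) => M1 M2 M3.
by rewrite !mxE; ring.
Qed.

Lemma frobeniusDl A B X : frobenius (A + B) X = frobenius A X + frobenius B X.
Proof.
rewrite /frobenius -big_split; apply: eq_bigr => i _ /=; rewrite -big_split.
by apply: eq_bigr => j _; rewrite mxE mulrDl.
Qed.

Lemma frobeniusZl a A X : frobenius (a *: A) X = a * frobenius A X.
Proof.
rewrite /frobenius mulr_sumr; apply: eq_bigr => i _ /=; rewrite mulr_sumr.
by apply: eq_bigr => j _; rewrite mxE mulrA.
Qed.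

Lemma frobeniusC A X : frobenius A X = frobenius X A.
Proof. by apply: eq_bigr => i _; apply: eq_bigr => j _; rewrite mulrC. Qed.

Lemma frobeniusDr A X Y : frobenius A (X + Y) = frobenius A X + frobenius A Y.
Proof. by rewrite frobeniusC frobeniusDl !(frobeniusC A). Qed.

Lemma frobeniusZr a A X : frobenius A (a *: X) = a * frobenius A X.
Proof. by rewrite frobeniusC frobeniusZl frobeniusC. Qed.

Lemma frobenius_rank1 p X : frobenius (p^T *m p) X = quadform X p.
Proof.
rewrite quadformE; apply: eq_bigr => i _; apply: eq_bigr => j _.
by rewrite !mxE big_ord1 mxE mulrC.
Qed.

Lemma frobenius_scalar A a : frobenius A a%:M = a * \tr A.
Proof.
rewrite /frobenius /mxtrace mulr_sumr; apply: eq_bigr => i _.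
rewrite (bigD1 i)//= big1 ?addr0 => [|j ji]; rewrite mxE ?eqxx ?mulr1n 1?mulrC//.
by rewrite eq_sym (negbTE ji) mulr0n mul0r.
Qed.

(** When the diagonal entry vanishes, the form at e_j + a e_k is affine in a. An affine function
    that stays non-negative has slope zero; otherwise the value of a chosen below makes it -1. *)
Lemma psd_diag0 A (k j : 'I_d) : A^T = A -> (forall xi, 0 <= quadform A xi) ->
  A k k = 0 -> A k j = 0.
Proof.
move=> symA psdA Akk.
have h a : 0 <= A j j + 2 * a * A k j.
  have := psdA (delta_mx 0 j + a *: delta_mx 0 k).
  rewrite quadform_lin// !quadform_delta Akk mulr0 addr0.
  suff -> : ((delta_mx 0 j : 'rV[R]_d) *m A *m (delta_mx 0 k : 'rV[R]_d)^T) 0 0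
    = A k j by [].
  rewrite -rowE -{1}symA -tr_col trmx_delta -colE.
  by rewrite !mxE.
apply/eqP; apply: contraT => Akj.
have := h (- (A j j + 1) / (2 * A k j)).
suff -> : A j j + 2 * (- (A j j + 1) / (2 * A k j)) * A k j = - 1.
  by rewrite oppr_ge0 ler10.
by field.
Qed.

(* Schur complements: eliminating one row at a time writes A as a sum of
   matrices v^T v, and the Frobenius product of v^T v with X is <X v, v>. *)
Lemma frobenius_psd_ge0 A X : A^T = A -> (forall xi, 0 <= quadform A xi) ->
  (forall xi, 0 <= quadform X xi) -> 0 <= frobenius A X.
Proof.
move=> + + psdX.
(* Induction on the number n of leading rows that may be non-zero; n = d imposes nothing. *)
suff H n : forall A, A^T = A -> (forall xi, 0 <= quadform A xi) ->
    (forall i j : 'I_d, (n <= i)%N -> A i j = 0) -> 0 <= frobenius A X.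
  move=> sA pA; apply: (H d) => // i j.
  by rewrite leqNgt ltn_ord.
elim: n => [{}A _ _ A0|n IHn {}A symA psdA A0].
  by rewrite /frobenius big1// => i _; rewrite big1// => j _; rewrite A0// mul0r.
have [dn|nd] := leqP d n.
  apply: IHn => // i j ni; exfalso.
  by have := ltn_ord i; rewrite ltnNge (leq_trans dn ni).
pose k := Ordinal nd.
(* With a zero pivot, row k vanishes already and nothing has to be eliminated. *)
have [Akk|Akk] := eqVneq (A k k) 0.
  apply: IHn => // i j; rewrite leq_eqVlt => /orP[/eqP ni|]; last exact: A0.
  by have -> : i = k by [apply: val_inj; rewrite /= ni]; exact: psd_diag0.
have Akk_gt0 : 0 < A k k.
  by rewrite lt_def Akk -quadform_delta psdA.
pose v := row k A.
have AE : A = (A - (A k k)^-1 *: (v^T *m v)) + (A k k)^-1 *: (v^T *m v).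
  by rewrite subrK.
have Aik i : A i k = A k i by rewrite -{1}symA mxE.
rewrite AE frobeniusDl frobeniusZl frobenius_rank1 addr_ge0//; last first.
  by rewrite mulr_ge0// invr_ge0 ltW.
apply: IHn.
- by rewrite linearB/= linearZ/= trmx_mul trmxK symA.
- move=> xi.
  (* The Schur complement at xi equals the form of A at xi shifted along e_k, the shift being the
     one that minimises the form. *)
  have := psdA (xi + (- dotrv v xi / A k k) *: delta_mx 0 k).
  rewrite quadform_lin// quadform_delta quadformB quadformZ quadform_rank1.
  have -> : (xi *m A *m (delta_mx 0 k : 'rV[R]_d)^T) 0 0 = dotrv v xi.
    rewrite trmx_delta -mulmxA -colE mxE.
    by apply: eq_bigr => i _; rewrite !mxE Aik mulrC.
  move=> h; apply: (le_trans h); rewrite le_eqVlt; apply/orP; left; apply/eqP.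
  by field.
- move=> i j; rewrite leq_eqVlt => /orP[/eqP ni|ni].
    have -> : i = k by apply: val_inj; rewrite /= ni.
    by rewrite !mxE big_ord1 !mxE mulrA mulVf// mul1r subrr.
  by rewrite !mxE big_ord1 !mxE -(Aik i) !(A0 i)// mul0r mulr0 subr0.
Qed.

Lemma frobenius_psd_le A X Y : A^T = A -> (forall xi, 0 <= quadform A xi) ->
  (forall xi, quadform X xi <= quadform Y xi) -> frobenius A X <= frobenius A Y.
Proof.
move=> symA psdA XY; rewrite -subr_ge0.
have -> : frobenius A Y - frobenius A X = frobenius A (Y - X).
  by rewrite -[- X]scaleN1r frobeniusDr frobeniusZr mulN1r.
by apply: frobenius_psd_ge0 => // xi; rewrite quadformB subr_ge0.
Qed.

End quadratic_forms.

(** * Derivatives along lines *)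

Section calculus.
Variable R : realType.

(** The multiplied form of the difference quotient includes h = 0 and avoids division; most
    derivatives below are checked or exploited through it. *)
Lemma is_derive_epsP (V : normedModType R) (f : V -> R) (x v : V) (D : R) :
  is_derive x v f D <->
  forall e, 0 < e -> exists2 del, 0 < del &
    forall h, `|h| < del -> `|f (x + h *: v) - f x - h * D| <= e * `|h|.
Proof.
have key e h : h != 0 ->
    (`|D - h^-1 *: (f (h *: v + x) - f x)| <= e) =
    (`|f (x + h *: v) - f x - h * D| <= e * `|h|).
  move=> h0; rewrite -ler_pdivrMr ?normr_gt0// -normf_div distrC.
  by congr (`|_| <= _); rewrite [x + _]addrC /GRing.scale/=; field.
split=> [dfx e e0|H].
  have : (fun h => h^-1 *: ((f \o shift x) (h *: v) - f x)) @ 0^' --> D.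
    by case: dfx => ? <-.
  move=> /cvgrPdist_le /(_ e e0) [del /= del0 H].
  exists del => // h hdel; have [->|h0] := eqVneq h 0.
    by rewrite scale0r addr0 subrr mul0r subrr normr0 mulr0.
  by rewrite -key//; apply: H => //; rewrite /ball_/= sub0r normrN.
have Hc : (fun h => h^-1 *: ((f \o shift x) (h *: v) - f x)) @ 0^' --> D.
  apply/cvgrPdist_le => e e0; have [del del0 {}H] := H e e0.
  exists del => // h; rewrite /ball_/= sub0r normrN => hdel h0.
  by rewrite key//; exact: H.
by apply: DeriveDef; [apply/cvg_ex; exists D|exact: cvg_lim Hc].
Qed.

Lemma is_derive_unique (V : normedModType R) (f : V -> R) (x v : V) (D D' : R) :
  is_derive x v f D -> is_derive x v f D' -> D = D'.
Proof. by case=> _ <- [_ <-]. Qed.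

Lemma is_derive_line (V : normedModType R) (f : V -> R) (x v : V) (z D : R) :
  is_derive (x + z *: v) v f D -> is_derive z 1 (fun z => f (x + z *: v)) D.
Proof.
move=> /is_derive_epsP H; apply/is_derive_epsP => e /H[del del0 {}H].
exists del => // h /H; rewrite -(addrA x) -scalerDl.
by rewrite /GRing.scale/= mulr1.
Qed.

Lemma MVT_line (V : normedModType R) (f p : V -> R) (x v : V) (s : R) :
  (forall y, is_derive y v f (p y)) ->
  exists2 c, `|c| <= `|s| & f (x + s *: v) - f x = s * p (x + c *: v).
Proof.
move=> dfp; pose g (z : R) : R := f (x + z *: v).
have dg (z : R) : is_derive z 1 g (p (x + z *: v)) by exact: is_derive_line.
have cg (a b : R) : {within `[a, b], continuous g}.
  by apply: derivable_within_continuous => z _; exact: ex_derive.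
have g0 : f x = g 0 by rewrite /g scale0r addr0.
have [s0|s0] := leP 0 s.
  have [c cs] := MVT_segment s0 (fun z _ => dg z) (@cg 0 s).
  rewrite g0 subr0 mulrC => ->; exists c => //.
  by rewrite !ger0_norm// (itvP cs).
have [c cs] := MVT_segment (ltW s0) (fun z _ => dg z) (@cg s 0).
rewrite g0 sub0r mulrN => gc; exists c.
  by rewrite !ler0_norm ?lerN2 ?(ltW s0)// (itvP cs).
by rewrite -/(g s) -opprB gc opprK mulrC.
Qed.

(** If g2 were positive, the expansion of g1 at 0 would make g1 positive just to the right of 0, and
    by the mean value theorem g would exceed its maximum there. *)
Lemma second_derivative_test (g g1 : R -> R) (g2 del : R) :
  (forall z : R, is_derive z 1 g (g1 z)) -> is_derive (0 : R) 1 g1 g2 -> 0 < del ->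
  (forall z, `|z| < del -> g z <= g 0) -> g1 0 = 0 /\ g2 <= 0.
Proof.
move=> dg dg1 del0 gmax.
have g10 : g1 0 = 0.
  have zdel (z : R) : z \in `](- del), del[ -> `|z| < del.
    by rewrite in_itv /= ltr_norml.
  apply: is_derive_unique (dg 0) _; apply: (@derive1_at_max _ _ (- del) del).
  - by rewrite lerNl (le_trans _ (ltW del0))// oppr_le0 ltW.
  - by move=> t _; exact: ex_derive.
  - by rewrite in_itv /= oppr_lt0 del0.
  - by move=> t /zdel; exact: gmax.
split=> //; rewrite leNgt; apply/negP => g2_gt0.
have /is_derive_epsP/(_ (g2 / 2)) := dg1.
rewrite divr_gt0// => /(_ isT)[del' del'0 H].
pose h := Num.min del del' / 2.
have h0 : 0 < h by rewrite divr_gt0// lt_min del0.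
have hm : h < Num.min del del' by rewrite ltr_pdivrMr// ltr_pMr ?lt_min ?del0 ?ltr1n//.
move: (hm); rewrite lt_min => /andP[hdel hdel'].
have cg : {within `[0, h], continuous g}.
  by apply: derivable_within_continuous => z _; exact: ex_derive.
have [c] := MVT h0 (fun z _ => dg z) cg.
rewrite in_itv /= => /andP[c0 ch] gh.
have := gmax h; rewrite gtr0_norm// => /(_ hdel); apply/negP; rewrite -ltNge.
rewrite -subr_gt0 gh subr0 mulr_gt0//.
have := H c; rewrite gtr0_norm// => /(_ (lt_trans ch hdel')).
rewrite add0r /GRing.scale/= mulr1 g10 subr0 ler_norml => /andP[+ _].
rewrite lerBrDr => /(lt_le_trans _); apply.
by have := mulr_gt0 c0 g2_gt0; lra.
Qed.

(** Meant for the time variable: the maximum may sit at the final time, so the comparison is with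
    earlier times only. *)
Lemma derive_ge0_left_max (g : R -> R) (t D del : R) :
  is_derive t 1 g D -> 0 < del ->
  (forall z, t - del < z <= t -> g z <= g t) -> 0 <= D.
Proof.
move=> /is_derive_epsP dg del0 gmax; rewrite leNgt; apply/negP => D0.
have [|del' del'0 H] := dg (- D / 2); first by rewrite divr_gt0// oppr_gt0.
pose h := Num.min del del' / 2.
have h0 : 0 < h by rewrite divr_gt0// lt_min del0.
have hm : h < Num.min del del' by rewrite ltr_pdivrMr// ltr_pMr ?lt_min ?del0 ?ltr1n//.
move: (hm); rewrite lt_min => /andP[hdel hdel'].
have := H (- h); rewrite normrN gtr0_norm// => /(_ hdel').
rewrite /GRing.scale/= mulr1 ler_norml => /andP[+ _].
have := gmax (t - h); rewrite gerBl (ltW h0) andbT ltrD2l ltrN2 => /(_ hdel).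
have : 0 < h * - D by rewrite mulr_gt0// oppr_gt0.
lra.
Qed.

End calculus.

(* Locked because unifying two distinct Hessians is prohibitively slow. *)
HB.lock Definition hessian (R : realType) (d : nat) (f : 'rV[R]_d -> R)
  (x : 'rV[R]_d) : 'M[R]_d := \matrix_(i, j) partial i (partial j f) x.

(** * Functions of class C^1 and C^2: directional derivatives and linearity of the operator *)

Section C1_functions.
Variables (R : realType) (d : nat).
Implicit Types (f g : 'rV[R]_d -> R) (x v : 'rV[R]_d).

Lemma is_derive_partial f x i :
  has_partial i f x -> is_derive x (delta_mx 0 i) f (partial i f x).
Proof. exact: derivableP. Qed.

(** The increment splits into h v followed by h a e_i. The first piece is the given derivative; the
    mean value theorem turns the second into h a times a partial derivative at a nearby point, which
    continuity compares with its value at x. *)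
Lemma is_derive_add_partial f x v (a D : R) (i : 'I_d) :
  (forall y, has_partial i f y) -> {for x, continuous (partial i f)} ->
  is_derive x v f D ->
  is_derive x (v + a *: delta_mx 0 i) f (D + a * partial i f x).
Proof.
move=> dfi cfi /is_derive_epsP dfv; apply/is_derive_epsP => e e0.
have e2 : 0 < e / 2 by rewrite divr_gt0.
have [del del0 Hv] := dfv _ e2.
have a1 : 0 < `|a| + 1 by rewrite ltr_wpDl.
have [r r0 Hr] : exists2 r, 0 < r &
    forall y, `|y| < r -> `|partial i f (x + y) - partial i f x| <= e / 2 / (`|a| + 1).
  have /cvgrPdist_le/(_ (e / 2 / (`|a| + 1))) := cfi.
  rewrite divr_gt0// => /(_ isT) /nbhs_ballP[r /= r0 Hr].
  exists r => // y yr; rewrite distrC; apply: Hr.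
  by rewrite -ball_normE /ball_/= opprD addrA subrr sub0r normrN.
(* The intermediate point lies within |h| n of x, so |h| < r / n keeps it in the ball of radius
   r. *)
pose n := `|v| + `|a| * `|delta_mx 0 i : 'rV[R]_d| + 1.
have n0 : 0 < n by rewrite ltr_wpDl// addr_ge0// mulr_ge0.
exists (Num.min del (r / n)); first by rewrite lt_min del0 divr_gt0.
move=> h; rewrite lt_min => /andP[hdel hr].
have [c ch Hc] := MVT_line (x + h *: v) (h * a)
  (fun y => is_derive_partial (dfi y)).
have -> : f (x + h *: (v + a *: delta_mx 0 i)) =
    f (x + h *: v + (h * a) *: delta_mx 0 i).
  by rewrite scalerDr scalerA addrA.
have -> : f (x + h *: v + (h * a) *: delta_mx 0 i) - f x
    - h * (D + a * partial i f x) = (f (x + h *: v) - f x - h * D) +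
    h * a * (partial i f (x + (h *: v + c *: delta_mx 0 i)) - partial i f x).
  by rewrite -[f (_ + _ + _)](subrK (f (x + h *: v))) Hc addrA; ring.
rewrite (le_trans (ler_normD _ _))// [e]splitr mulrDl lerD ?Hv//.
have Hp := Hr (h *: v + c *: delta_mx 0 i).
have {}Hp : `|partial i f (x + (h *: v + c *: delta_mx 0 i)) - partial i f x| <=
    e / 2 / (`|a| + 1).
  apply: Hp; rewrite (le_lt_trans (ler_normD _ _))// !normrZ.
  move: hr; rewrite ltr_pdivlMr//; apply: le_lt_trans.
  rewrite /n !mulrDr -addrA lerD2l mulr1 ler_wpDr//.
  by rewrite mulrA -normrM ler_wpM2r.
apply: (@le_trans _ _ (`|h| * ((`|a| + 1) * (e / 2 / (`|a| + 1))))).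
  by rewrite !normrM -mulrA ler_wpM2l// ler_pM// lerDl.
by rewrite [(`|a| + 1) * _]mulrC divfK ?gt_eqF// mulrC.
Qed.

Lemma dotrv_row v (F : 'I_d -> R) : dotrv v (\row_i F i) = \sum_i v 0 i * F i.
Proof. by apply: eq_bigr => i _; rewrite mxE. Qed.

Lemma is_derive_C1 f x v : is_C1 f -> is_derive x v f (dotrv v (grad f x)).
Proof.
move=> [_ C1f]; rewrite dotrv_row.
(* The direction is built up one coordinate at a time. *)
suff H (r : seq 'I_d) : is_derive x (\sum_(i <- r) v 0 i *: delta_mx 0 i) f
    (\sum_(i <- r) v 0 i * partial i f x).
  by rewrite {1}(row_sum_delta v); exact: H.
elim: r => [|i r IHr].
  rewrite !big_nil; apply/is_derive_epsP => e e0; exists 1 => // h _.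
  by rewrite scaler0 addr0 subrr mulr0 subr0 normr0 mulr_ge0 // ltW.
rewrite !big_cons addrC [X in is_derive _ _ _ X]addrC.
have [dfi cfi] := C1f i.
apply: is_derive_add_partial; [exact: dfi|exact: cfi].
Qed.

Lemma operatorA_frobenius Q b (t : R) f x :
  operatorA Q b t f x =
  frobenius (Q t x) (hessian f x) + dotrv (b t x) (grad f x).
Proof.
rewrite dotrv_row; congr (_ + _).
by apply: eq_bigr => i _; apply: eq_bigr => j _; rewrite hessian.unlock mxE.
Qed.

Lemma is_derive_C1_line f x v (z : R) : is_C1 f ->
  is_derive z 1 (fun z : R => f (x + z *: v)) (dotrv v (grad f (x + z *: v))).
Proof. by move=> C1f; apply: is_derive_line; exact: is_derive_C1. Qed.

Lemma is_derive_C2_line f x v (z : R) : is_C2 f ->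
  is_derive z 1 (fun z : R => dotrv v (grad f (x + z *: v)))
    (quadform (hessian f (x + z *: v)) v).
Proof.
move=> [C1f C2f].
have -> : (fun z : R => dotrv v (grad f (x + z *: v))) =
    \sum_(j < d) v 0 j *: (fun z : R => partial j f (x + z *: v)).
  by apply/funext => y; rewrite dotrv_row fct_sumE.
apply: is_derive_eq.
  by apply: is_derive_sum => j; apply: is_deriveZ; exact: is_derive_C1_line.
rewrite quadformE exchange_big /=; apply: eq_bigr => j _.
rewrite /GRing.scale/= dotrv_row mulr_sumr; apply: eq_bigr => i _.
by rewrite hessian.unlock mxE; ring.
Qed.

Lemma is_derive_C2_line0 f x v : is_C2 f ->
  is_derive (0 : R) 1 (fun z : R => dotrv v (grad f (x + z *: v)))
    (quadform (hessian f x) v).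
Proof.
move=> C2f; have := is_derive_C2_line x v 0 C2f.
by have -> : x + 0 *: v = x by rewrite scale0r addr0.
Qed.

Lemma partialDZ f g (c : R) i : (forall x, has_partial i f x) ->
  (forall x, has_partial i g x) ->
  partial i (fun x => f x + c * g x) = fun x => partial i f x + c * partial i g x.
Proof.
move=> df dg; apply/funext => x.
have := deriveD (df x) (derivableZ (k := c) (dg x)).
by rewrite (deriveZ c (dg x)) => E; exact: E.
Qed.

Lemma is_C1DZ f g (c : R) : is_C1 f -> is_C1 g -> is_C1 (fun x => f x + c * g x).
Proof.
have cD (u w : 'rV[R]_d -> R) : continuous u -> continuous w ->
    continuous (fun x => u x + c * w x).
  by move=> cu cw x; exact: (cvgD (cu x) (cvgM (cvg_cst c) (cw x))).
move=> [cf df] [cg dg]; split; first exact: cD.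
move=> i; have [df1 df2] := df i; have [dg1 dg2] := dg i.
rewrite (@partialDZ f g c i df1 dg1); split; last exact: cD.
by move=> x; exact: (derivableD (df1 x) (derivableZ (k := c) (dg1 x))).
Qed.

Lemma is_C2DZ f g (c : R) : is_C2 f -> is_C2 g -> is_C2 (fun x => f x + c * g x).
Proof.
move=> [C1f C2f] [C1g C2g]; split=> [|i]; first exact: is_C1DZ.
rewrite (@partialDZ f g c i (proj1 (proj2 C1f i)) (proj1 (proj2 C1g i))).
exact: is_C1DZ.
Qed.

Lemma operatorADZ Q b (t : R) f g (c : R) x : is_C2 f -> is_C2 g ->
  operatorA Q b t (fun x => f x + c * g x) x =
  operatorA Q b t f x + c * operatorA Q b t g x.
Proof.
move=> [[_ C1f] C2f] [[_ C1g] C2g].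
have d1 j := @partialDZ f g c j (proj1 (C1f j)) (proj1 (C1g j)).
have d2 i j := @partialDZ _ _ c i (proj1 (proj2 (C2f j) i)) (proj1 (proj2 (C2g j) i)).
rewrite /operatorA mulrDr addrACA; congr (_ + _).
  rewrite mulr_sumr -big_split; apply: eq_bigr => i _ /=.
  rewrite mulr_sumr -big_split; apply: eq_bigr => j _ /=.
  rewrite (congr1 (fun F => partial i F x) (d1 j)) (congr1 (@^~ x) (d2 i j)).
  move: (partial i _ x) (partial i _ x) => p q.
  by ring.
rewrite mulr_sumr -big_split; apply: eq_bigr => i _ /=.
by rewrite d1; ring.
Qed.

End C1_functions.

(** * Comparison of the coefficients at two points *)

Section doubling.
Variables (R : realType) (d : nat).
Implicit Types (x y p v xi : 'rV[R]_d).

Lemma ler_enormD (u v : 'rV[R]_d) : enorm (u + v) <= enorm u + enorm v.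
Proof.
have uv : dotrv u v <= enorm u * enorm v.
  rewrite (le_trans (ler_norm _))//.
  rewrite -(ler_pXn2r (n := 2)) ?nnegrE ?mulr_ge0 ?enorm_ge0//.
  by rewrite real_normK ?num_real// exprMn cauchy_schwarz.
rewrite -(ler_pXn2r (n := 2)) ?nnegrE ?addr_ge0 ?enorm_ge0//.
rewrite sqrrD [leLHS]sqr_enorm dotrvDl !dotrvDr (dotrvC v u) -!sqr_enorm.
lra.
Qed.

(** Mean value theorem for z -> <bb(y + z v), v> on [0, 1], v = x - y: its derivative is the form of
    the Jacobian at v. *)
Lemma dissipative_increment (bb : 'rV[R]_d -> 'rV[R]_d) (k : R) x y :
  (forall i, is_C1 (fun x => bb x 0 i)) ->
  (forall x xi, quadform (jacobian_mx bb x) xi <= k * enorm xi ^+ 2) ->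
  dotrv (bb x - bb y) (x - y) <= k * enorm (x - y) ^+ 2.
Proof.
move=> C1b diss; set v := x - y.
pose g (z : R) : R := \sum_(i < d) v 0 i * bb (y + z *: v) 0 i.
have dg (z : R) : is_derive z 1 g (quadform (jacobian_mx bb (y + z *: v)) v).
  have -> : g = \sum_(i < d) v 0 i *: (fun z : R => bb (y + z *: v) 0 i).
    by apply/funext => w; rewrite fct_sumE.
  apply: is_derive_eq.
    apply: is_derive_sum => i; apply: is_deriveZ.
    exact: (is_derive_C1_line _ _ _ (C1b i)).
  rewrite quadformE; apply: eq_bigr => i _.
  rewrite /GRing.scale/= dotrv_row mulr_sumr; apply: eq_bigr => j _.
  by rewrite [jacobian_mx _ _ _ _]mxE [LHS]mulrA; exact: mulrC.
have cg : {within `[0, 1], continuous g}.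
  by apply: derivable_within_continuous => z _; exact: ex_derive.
have [c _] := MVT ltr01 (fun z _ => dg z) cg.
rewrite subr0 mulr1 /g scale1r scale0r addr0 [y + v]addrC subrK => E.
apply: le_trans (diss (y + c *: v) v); rewrite -E -sumrB.
rewrite le_eqVlt; apply/orP; left; apply/eqP; apply: eq_bigr => i _.
by rewrite !mxE; ring.
Qed.

Lemma quadform_entry_bound (A : 'M[R]_d) (c : R) xi :
  (forall i j, `|A i j| <= c) ->
  `|quadform A xi| <= d%:R ^+ 2 * c * enorm xi ^+ 2.
Proof.
move=> Ac; rewrite quadformE (le_trans (ler_norm_sum _ _ _))//.
apply: (@le_trans _ _ (\sum_(i < d) \sum_(j < d) c * enorm xi ^+ 2)).
  apply: ler_sum => i _; rewrite (le_trans (ler_norm_sum _ _ _))//.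
  apply: ler_sum => j _; rewrite !normrM ler_pM ?mulr_ge0//.
  by rewrite expr2 ler_pM// ler_coord_enorm.
rewrite !sumr_const !card_ord -[leLHS]mulr_natr -[_ *+ d]mulr_natr.
by rewrite le_eqVlt; apply/orP; left; apply/eqP; ring.
Qed.

(* m is the supremum of et on a segment around [x, y]: the gradient bound makes
   q vary by at most kap |x - y| m there, and then ellipticity transfers the
   lower bound m to q x without any regularity of et. *)
Lemma diffusion_comparison (q : 'rV[R]_d -> 'M[R]_d) (et : 'rV[R]_d -> R)
    (rho eta0 : R) x y :
  (forall i j, is_C1 (fun x => q x i j)) ->
  (forall x xi, et x * enorm xi ^+ 2 <= quadform (q x) xi) ->
  (forall x, eta0 <= et x) -> 0 < eta0 -> 0 <= rho ->
  (forall i j k x, `|partial k (fun y => q y i j) x| <= rho * et x) ->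
  x != y ->
  let kap := d%:R ^+ 3 * rho * enorm (x - y) in
  exists m, [/\ eta0 <= m,
    forall xi, `|quadform (q y - q x) xi| <= kap * m * enorm xi ^+ 2 &
    forall xi, (1 - kap) * m * enorm xi ^+ 2 <= quadform (q x) xi].
Proof.
move=> C1q ell eta0P eta0_gt0 rho0 diff xy kap.
pose v := y - x; pose S := [set et (x + z *: v) | z in `[-1, 1]].
have v0 : 0 < enorm v by rewrite lt_def enorm_ge0 enorm_eq0 subr_eq0 eq_sym xy.
(* The supremum is finite although [et] need not be continuous: by ellipticity [et] is at most the
   form of q at v divided by |v|^2, and this is continuous on the segment. *)
have supS : has_sup S.
  split; first by exists (et (x + 0 *: v)), 0 => //=; rewrite in_itv/= lerN10 ler01.
  pose g (z : R) : R := quadform (q (x + z *: v)) v.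
  have cg : {within `[-1, 1], continuous g}.
    apply: derivable_within_continuous => z _.
    have -> : g = \sum_(i < d) \sum_(j < d) (v 0 i * v 0 j) *:
        (fun z : R => q (x + z *: v) i j).
      apply/funext => w; rewrite /g quadformE fct_sumE; apply: eq_bigr => i _.
      by rewrite fct_sumE; apply: eq_bigr => j _; rewrite mulrC.
    apply: derivable_sum => i; apply: derivable_sum => j; apply: derivableZ.
    by have [] := is_derive_C1_line x v z (C1q i j).
  have [|c _ gc] := @EVT_max R g (-1) 1 _ cg; first by lra.
  exists (g c / enorm v ^+ 2) => _ [z zI <-].
  by rewrite ler_pdivlMr ?exprn_gt0// (le_trans (ell _ _))// gc.
pose m := sup S.
have etm z : `|z| <= 1 -> et (x + z *: v) <= m.
  move=> z1; apply: sup_upper_bound => //; exists z => //=.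
  by rewrite in_itv/= -ler_norml.
have m_ge : eta0 <= m by rewrite (le_trans (eta0P _) (etm 0 _))// normr0.
have m0 : 0 < m := lt_le_trans eta0_gt0 m_ge.
(* The factor d^3 in [kap] is d^2 from the entries of the form times d from the partial derivatives
   in the gradient of each entry. *)
have dq z xi : `|z| <= 1 ->
    `|quadform (q (x + z *: v) - q x) xi| <= kap * m * enorm xi ^+ 2.
  move=> z1.
  have -> : kap * m * enorm xi ^+ 2 =
      d%:R ^+ 2 * (d%:R * (enorm v * (rho * m))) * enorm xi ^+ 2.
    by rewrite /kap -enormN opprB -/v; ring.
  apply: quadform_entry_bound => i j; rewrite !mxE.
  have [c cz ->] := MVT_line x z (fun y => is_derive_C1 y v (C1q i j)).
  rewrite normrM (@le_trans _ _ (1 * (d%:R * (enorm v * (rho * m)))))//; last first.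
    by rewrite mul1r.
  rewrite ler_pM// dotrv_row (le_trans (ler_norm_sum _ _ _))//.
  apply: (@le_trans _ _ (\sum_(k < d) enorm v * (rho * m))).
    apply: ler_sum => k _; rewrite normrM ler_pM ?ler_coord_enorm//.
    by rewrite (le_trans (diff _ _ _ _))// ler_wpM2l// etm// (le_trans cz).
  by rewrite sumr_const card_ord mulr_natl.
exists m; split=> [//|xi|xi].
  have := dq 1 xi; rewrite scale1r [x + v]addrC subrK normr1.
  by apply; exact: lexx.
have [->|xi0] := eqVneq xi 0.
  by rewrite enorm0 expr0n/= mulr0 /quadform !mul0mx mxE.
have xi_gt0 : 0 < enorm xi ^+ 2.
  by rewrite exprn_gt0// lt_def enorm_ge0 enorm_eq0 xi0.
rewrite -mulrA mulrBl mul1r lerBlDr mulrA -ler_pdivlMr//.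
(* It suffices to bound each [et] on the segment: ellipticity holds at that point, and passing from
   there to x costs at most kap m |xi|^2. *)
apply: ge_sup; first by case: supS.
move=> _ [z /= zI <-]; rewrite ler_pdivlMr// (le_trans (ell _ _))//.
have : `|z| <= 1 by rewrite ler_norml; rewrite in_itv in zI.
move=> z1; have := dq z xi z1; rewrite quadformB ler_norml => /andP[_].
by rewrite lerBlDl.
Qed.

End doubling.

(** * The maximum point of the doubled function *)

Section doubling_core.
Variables (R : realType) (d : nat).
Implicit Types (x y p v xi : 'rV[R]_d).

Lemma sqr_enorm_line p xi (z : R) :
  enorm (p + z *: xi) ^+ 2 =
  enorm p ^+ 2 + 2 * z * dotrv p xi + z ^+ 2 * enorm xi ^+ 2.
Proof.
rewrite !sqr_enorm dotrvDl !dotrvDr !dotrvZl !dotrvZr (dotrvC xi p).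
by ring.
Qed.

Lemma is_derive_sqr_enorm_line p xi (c z : R) :
  is_derive z 1 (fun z : R => c / 2 * (2 * z * dotrv p xi + z ^+ 2 * enorm xi ^+ 2))
    (c * (dotrv p xi + z * enorm xi ^+ 2)).
Proof.
apply/is_derive_epsP => e e0; pose C := `|c / 2| * enorm xi ^+ 2 + 1.
have C0 : 0 < C by rewrite ltr_wpDl// mulr_ge0// sqr_ge0.
exists (e / C); first exact: divr_gt0.
move=> h; rewrite /GRing.scale/= mulr1 ltr_pdivlMr// => hC.
rewrite (_ : _ - _ = h * (h * (c / 2 * enorm xi ^+ 2))); last by field.
rewrite normrM mulrC ler_wpM2r// normrM.
apply: le_trans (ltW hC); rewrite ler_wpM2l//.
by rewrite normrM [`|enorm _ ^+ 2|]ger0_norm ?sqr_ge0// /C lerDl.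
Qed.

(** The difference of h and the paraboloid, restricted to the line through p, has a local maximum at
    z = 0; the second derivative test applies to it. *)
Lemma paraboloid_contact (h h1 : R -> R) (h2 del c : R) p xi :
  (forall z : R, is_derive z 1 h (h1 z)) -> is_derive (0 : R) 1 h1 h2 ->
  enorm p < del ->
  (forall z, enorm (p + z *: xi) <= del ->
    h z - h 0 <= c / 2 * (enorm (p + z *: xi) ^+ 2 - enorm p ^+ 2)) ->
  h1 0 = c * dotrv p xi /\ h2 <= c * enorm xi ^+ 2.
Proof.
move=> dh dh1 pdel hmax.
pose k z := c / 2 * (2 * z * dotrv p xi + z ^+ 2 * enorm xi ^+ 2).
pose k1 z := c * (dotrv p xi + z * enorm xi ^+ 2).
have dk1 : is_derive (0 : R) 1 k1 (c * enorm xi ^+ 2).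
  apply/is_derive_epsP => e e0; exists 1 => // z _.
  rewrite /k1 /GRing.scale/= (_ : _ - _ = 0); last by ring.
  by rewrite normr0 mulr_ge0// ltW.
(* Keeps p + z xi in the ball of radius del; the + 1 covers xi = 0. *)
pose del' := (del - enorm p) / (enorm xi + 1).
have xi1 : 0 < enorm xi + 1 by rewrite ltr_wpDl// enorm_ge0.
have del'0 : 0 < del' by rewrite divr_gt0// subr_gt0.
have dhk (z : R) : is_derive z 1 (h \- k) ((h1 \- k1) z).
  exact: (is_deriveB (dh z) (is_derive_sqr_enorm_line _ _ _ _)).
have dhk1 : is_derive (0 : R) 1 (h1 \- k1) (h2 - c * enorm xi ^+ 2).
  exact: (is_deriveB dh1 dk1).
have [z zdel /=|] := second_derivative_test dhk dhk1 del'0.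
- have : enorm (p + z *: xi) <= del.
    rewrite (le_trans (ler_enormD _ _))// enormZ -lerBrDl.
    move: zdel; rewrite ltr_pdivlMr// => /ltW; apply: le_trans.
    by rewrite ler_wpM2l// lerDl.
  move=> /hmax; rewrite sqr_enorm_line /k => H.
  rewrite -subr_ge0 in H; rewrite -subr_ge0; apply: (le_trans H).
  by rewrite le_eqVlt; apply/orP; left; apply/eqP; ring.
- rewrite /= /k1 mul0r addr0 => /eqP; rewrite subr_eq0 => /eqP ->.
  by rewrite subr_le0.
Qed.

(** * The second-order inequality at an off-diagonal maximum, at a fixed time *)

Section core.
Variables (q : 'rV[R]_d -> 'M[R]_d) (bb : 'rV[R]_d -> 'rV[R]_d).
Variables (et : 'rV[R]_d -> R) (rho eta0 k0 del K : R).
Hypothesis C1q : forall i j, is_C1 (fun x => q x i j).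
Hypothesis C1b : forall i, is_C1 (fun x => bb x 0 i).
Hypothesis symq : forall x, (q x)^T = q x.
Hypothesis ell : forall x xi, et x * enorm xi ^+ 2 <= quadform (q x) xi.
Hypothesis etaP : forall x, eta0 <= et x.
Hypothesis eta0_gt0 : 0 < eta0.
Hypothesis diff : forall i j k x, `|partial k (fun y => q y i j) x| <= rho * et x.
Hypothesis diss : forall x xi, quadform (jacobian_mx bb x) xi <= k0 * enorm xi ^+ 2.
Hypothesis rho_ge0 : 0 <= rho.
Hypothesis k0_ge0 : 0 <= k0.
Hypothesis K_ge0 : 0 <= K.
Hypothesis del_kap : d%:R ^+ 3 * rho * del <= 4^-1.
Hypothesis del_dkap : 6 * d%:R * (d%:R ^+ 3 * rho) * del <= 1.
Hypothesis del_k0 : 2 * k0 * del ^+ 2 <= eta0.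

Variables (v w : 'rV[R]_d -> R) (x y : 'rV[R]_d).
Hypothesis C2v : is_C2 v.
Hypothesis C2w : is_C2 w.
Hypothesis xy : x != y.
Hypothesis xydel : enorm (x - y) < del.

Let psi (r : R) := 2 * K * del * r - K * r ^+ 2.
Hypothesis vw_max : forall x' y', enorm (x' - y') <= del ->
  v x' - w y' - psi (enorm (x' - y')) <= v x - w y - psi (enorm (x - y)).

Let p := x - y.
Let r := enorm p.
(** This is psi'(r) / r, the curvature of the paraboloid that touches the radial function psi from
    above at distance r. *)
Let c := 2 * K * del / r - 2 * K.

Let r_gt0 : 0 < r.
Proof. by rewrite lt_def enorm_ge0 enorm_eq0 subr_eq0 xy. Qed.

Let del_gt0 : 0 < del.
Proof. exact: lt_trans xydel. Qed.

Let c_ge0 : 0 <= c.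
Proof.
rewrite /c subr_ge0 ler_pdivlMr// ler_wpM2l ?mulr_ge0//.
exact: ltW.
Qed.

Let cr : c * r = 2 * K * (del - r).
Proof. by rewrite /c; field; rewrite gt_eqF. Qed.

(* a s <= a (s^2 + r^2) / (2 r) with equality at s = r. *)
Let psi_above s : psi s - psi r <= c / 2 * (s ^+ 2 - r ^+ 2).
Proof.
rewrite -subr_ge0 (_ : _ - _ = K * del / r * (s - r) ^+ 2); last first.
  by rewrite /psi /c; field; rewrite gt_eqF.
by rewrite mulr_ge0 ?sqr_ge0// mulr_ge0 ?invr_ge0 ?mulr_ge0// ltW.
Qed.

Let shift_sub (s1 s2 : R) (xi1 xi2 : 'rV[R]_d) :
  x + s1 *: xi1 - (y + s2 *: xi2) = p + (s1 *: xi1 - s2 *: xi2).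
Proof. by rewrite opprD addrACA. Qed.

(** Synchronous motion: moving both points by the same vector leaves x - y, and hence psi,
    unchanged. *)
Let hess_mono xi : quadform (hessian v x) xi <= quadform (hessian w y) xi.
Proof.
rewrite -subr_le0.
have [] := @second_derivative_test R
  (fun z => v (x + z *: xi) - w (y + z *: xi))
  (fun z => dotrv xi (grad v (x + z *: xi)) - dotrv xi (grad w (y + z *: xi)))
  (quadform (hessian v x) xi - quadform (hessian w y) xi) 1 => //.
- move=> z; apply: is_deriveB.
    exact: (is_derive_C1_line _ _ _ (proj1 C2v)).
  exact: (is_derive_C1_line _ _ _ (proj1 C2w)).
- exact: (is_deriveB (is_derive_C2_line0 x xi C2v) (is_derive_C2_line0 y xi C2w)).
- move=> z _; rewrite !scale0r !addr0.
  have := vw_max (x' := x + z *: xi) (y' := y + z *: xi).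
  by rewrite shift_sub subrr addr0 lerD2r => /(_ (ltW xydel)).
Qed.

(** Only x moves, and psi is replaced by the touching paraboloid. *)
Let first_var xi : dotrv xi (grad v x) = c * dotrv p xi /\
  quadform (hessian v x) xi <= c * enorm xi ^+ 2.
Proof.
have [] := @paraboloid_contact (fun z => v (x + z *: xi))
  (fun z => dotrv xi (grad v (x + z *: xi)))
  (quadform (hessian v x) xi) del c p xi _ _ xydel.
- by move=> z; exact: (is_derive_C1_line _ _ _ (proj1 C2v)).
- exact: is_derive_C2_line0.
- move=> z zdel; rewrite scale0r addr0; apply: le_trans (psi_above _).
  have := vw_max (x' := x + z *: xi) (y' := y).
  rewrite addrAC => /(_ zdel).
  rewrite -/p -/r; lra.
- by rewrite scale0r addr0.
Qed.

(** Only y moves; the difference vector then moves by - xi, hence the contact argument for - w in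
    the direction - xi. *)
Let second_var xi : dotrv xi (grad w y) = c * dotrv p xi /\
  - quadform (hessian w y) xi <= c * enorm xi ^+ 2.
Proof.
have [] := @paraboloid_contact (fun z => - w (y + z *: xi))
  (fun z => - dotrv xi (grad w (y + z *: xi)))
  (- quadform (hessian w y) xi) del c p (- xi) _ _ xydel.
- by move=> z; apply: is_deriveN; exact: (is_derive_C1_line _ _ _ (proj1 C2w)).
- by apply: is_deriveN; exact: is_derive_C2_line0.
- move=> z; rewrite scalerN => zdel; rewrite scale0r addr0.
  apply: le_trans (psi_above _).
  have := vw_max (x' := x) (y' := y + z *: xi).
  rewrite opprD addrA => /(_ zdel).
  rewrite -/p -/r; lra.
- rewrite scale0r addr0 enormN -[- xi]scaleN1r dotrvZr => H.
  by split=> //; lra.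
Qed.

(* Along (p, -p) the distance is affine, so the strict concavity of psi is
   seen in full. *)
Let reflected : quadform (hessian v x) p - quadform (hessian w y) p
  <= - 8 * K * r ^+ 2.
Proof.
(* The first bound keeps 1 + 2 z non-negative, so that the distance is r (1 + 2 z); the second keeps
   this distance at most del. *)
pose del' := Num.min (1 / 2) ((del - r) / (2 * r)).
have del'0 : 0 < del'.
  by rewrite lt_min !divr_gt0 ?subr_gt0// mulr_gt0.
pose k (z : R) := psi (r * (1 + 2 * z)).
pose k1 (z : R) := 4 * K * del * r - 4 * K * r ^+ 2 * (1 + 2 * z).
have Kr_ge0 : 0 <= 4 * K * r ^+ 2 by rewrite mulr_ge0 ?sqr_ge0// mulr_ge0.
have dk (z : R) : is_derive z 1 k (k1 z).
  apply/is_derive_epsP => e e0; pose C := 4 * K * r ^+ 2 + 1.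
  have C0 : 0 < C by rewrite ltr_wpDl.
  exists (e / C); first exact: divr_gt0.
  move=> h; rewrite /GRing.scale/= mulr1 ltr_pdivlMr// => hC.
  rewrite (_ : _ - _ = h * (h * - (4 * K * r ^+ 2))); last first.
    by rewrite /k /k1 /psi; ring.
  rewrite normrM mulrC ler_wpM2r// normrM normrN (ger0_norm Kr_ge0).
  by apply: le_trans (ltW hC); rewrite ler_wpM2l// /C lerDl.
have dk1 : is_derive (0 : R) 1 k1 (- 8 * K * r ^+ 2).
  apply/is_derive_epsP => e e0; exists 1 => // z _.
  rewrite /k1 /GRing.scale/= (_ : _ - _ = 0); last by ring.
  by rewrite normr0 mulr_ge0// ltW.
have dv := is_derive_C2_line0 x p C2v.
have dw := is_derive_eq (is_derive_C2_line0 y (- p) C2w) (quadform_opp (hessian w y) p).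
have dg (z : R) : is_derive z 1 (fun z => v (x + z *: p) - w (y + z *: - p) - k z)
    (dotrv p (grad v (x + z *: p)) - dotrv (- p) (grad w (y + z *: - p)) - k1 z).
  apply: is_deriveB; apply: is_deriveB.
    exact: (is_derive_C1_line _ _ _ (proj1 C2v)).
  exact: (is_derive_C1_line _ _ _ (proj1 C2w)).
have dg1 : is_derive (0 : R) 1 (fun z =>
    dotrv p (grad v (x + z *: p)) - dotrv (- p) (grad w (y + z *: - p)) - k1 z)
    (quadform (hessian v x) p - quadform (hessian w y) p - (- 8 * K * r ^+ 2)).
  exact: (is_deriveB (is_deriveB dv dw) dk1).
have [z|_] := second_derivative_test dg dg1 del'0.
- rewrite lt_min => /andP[z2 zr]; rewrite !scale0r !addr0.
  have z12 : 0 <= 1 + 2 * z by move: z2; rewrite ltr_norml => /andP[]; lra.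
  have E : enorm (p + (z *: p - z *: - p)) = r * (1 + 2 * z).
    rewrite scalerN opprK -{1}[p]scale1r -!scalerDl enormZ mulrC.
    by rewrite ger0_norm; [rewrite -/r; ring|lra].
  have := vw_max (x' := x + z *: p) (y' := y + z *: - p).
  rewrite shift_sub E /k mulr0 addr0 mulr1 -/p -/r; apply.
  move: zr; rewrite ltr_pdivlMr ?mulr_gt0// => zr.
  have := ler_norm z; have := r_gt0; nra.
- by rewrite subr_le0.
Qed.

(** Both q x and q y are written as P + mu p^T p plus a remainder. The common part P is handled by
    [hess_mono], the rank-one part by [reflected], the remainders [A1] and [A2] by the one-point
    variations. The gain - 4 K m pays for a loss K m from the remainders and K eta0 from the
    drift. *)
Lemma doubling_operator_bound :
  frobenius (q x) (hessian v x) + dotrv (bb x) (grad v x) -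
  (frobenius (q y) (hessian w y) + dotrv (bb y) (grad w y)) <= - 2 * K * eta0.
Proof.
have [m [etam dqP qP]] := diffusion_comparison C1q ell etaP eta0_gt0 rho_ge0 diff xy.
rewrite -/p -/r in dqP qP.
set kap := d%:R ^+ 3 * rho * r in dqP qP.
have m0 : 0 < m := lt_le_trans eta0_gt0 etam.
have rdel : r <= del := ltW xydel.
have kap_ge0 : 0 <= kap by rewrite !mulr_ge0 ?exprn_ge0 ?ler0n// ltW.
have kap4 : kap <= 4^-1.
  by apply: le_trans del_kap; rewrite ler_wpM2l// mulr_ge0 ?exprn_ge0 ?ler0n.
(* With this mu, mu p^T p is (m/2) e e^T for the unit vector e along p. *)
pose mu := m / 2 / r ^+ 2.
pose A1 : 'M[R]_d := (kap * m)%:M.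
(* Subtracting [A1] from q x leaves the remainder [A2] for q y; the multiple kap m of the identity
   is large enough to make it positive semidefinite. *)
pose A2 := q y - q x + A1.
pose P := q x - A1 - mu *: (p^T *m p).
have trB (A B : 'M[R]_d) : (A - B)^T = A^T - B^T.
  by apply/matrixP => i j; rewrite !mxE.
have symA1 : A1^T = A1 by rewrite tr_scalar_mx.
have symA2 : A2^T = A2 by rewrite [A2^T]raddfD/= trB !symq symA1.
have symP : P^T = P.
  by rewrite !trB symq symA1 [(_ *: _)^T]linearZ/= trmx_mul trmxK.
have r2_gt0 : 0 < r ^+ 2 by rewrite exprn_gt0.
(* The form of P is at least (1 - kap) m - kap m - m/2 times |xi|^2, which is non-negative since kap
   <= 1/4. *)
have psdP xi : 0 <= quadform P xi.
  rewrite !quadformB quadformZ quadform_rank1 quadform_scalar.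
  have h1 := qP xi.
  have h2 : mu * dotrv p xi ^+ 2 <= m / 2 * enorm xi ^+ 2.
    rewrite /mu -mulrA ler_wpM2l ?divr_ge0 ?(ltW m0)//.
    by rewrite ler_pdivrMl// cauchy_schwarz.
  have h3 : kap * (m * enorm xi ^+ 2) <= 4^-1 * (m * enorm xi ^+ 2).
    by rewrite ler_wpM2r// mulr_ge0 ?sqr_ge0// ltW.
  lra.
have psdA1 xi : 0 <= quadform A1 xi.
  rewrite quadform_scalar; apply: mulr_ge0; last exact: sqr_ge0.
  by apply: mulr_ge0 => //; exact: ltW.
have psdA2 xi : 0 <= quadform A2 xi.
  rewrite quadformD quadform_scalar.
  by have := dqP xi; rewrite ler_norml => /andP[+ _]; lra.
have qxE : q x = P + mu *: (p^T *m p) + A1 by rewrite /P subrK subrK.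
have qyE : q y = P + mu *: (p^T *m p) + A2.
  by rewrite /P subrK /A2 [RHS]addrC -addrA [A1 + _]addrC subrK subrK.
have HP := frobenius_psd_le symP psdP hess_mono.
have HA1 : frobenius A1 (hessian v x) <= c * (d%:R * (kap * m)).
  apply: (@le_trans _ _ (frobenius A1 c%:M)).
    apply: frobenius_psd_le => // xi; rewrite quadform_scalar.
    by have [] := first_var xi.
  by rewrite frobenius_scalar mxtrace_scalar mulr_natl.
(* The trace of [A2] is at most 2 d kap m: [A1] gives d kap m, and each diagonal entry of q y - q x
   is the value of its form at a basis vector. *)
have HA2 : - frobenius A2 (hessian w y) <= c * (2 * d%:R * (kap * m)).
  rewrite -mulN1r -frobeniusZr scaleN1r.
  apply: (@le_trans _ _ (frobenius A2 c%:M)).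
    apply: frobenius_psd_le => // xi; rewrite quadform_scalar quadformN.
    by have [] := second_var xi.
  rewrite frobenius_scalar ler_wpM2l// /A2 mxtraceD mxtrace_scalar.
  rewrite -[(kap * m) *+ d]mulr_natl -mulrA [2 * _]mulr_natl mulr2n lerD//.
  have -> : d%:R * (kap * m) = \sum_(i < d) kap * m.
    by rewrite sumr_const card_ord mulr_natl.
  apply: ler_sum => i _; rewrite -quadform_delta (le_trans (ler_norm _))//.
  rewrite (le_trans (dqP _))// sqr_enorm dotrv_delta mxE !eqxx mulr1//.
have Hb : dotrv (bb x) (grad v x) - dotrv (bb y) (grad w y) <= c * (k0 * r ^+ 2).
  have [-> _] := first_var (bb x); have [-> _] := second_var (bb y).
  rewrite -mulrBr ler_wpM2l//.
  have := dissipative_increment x y C1b diss.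
  by rewrite dotrvBl -/p -/r !(dotrvC p).
have Hr := reflected.
have FE (P0 A X : 'M[R]_d) : frobenius (P0 + mu *: (p^T *m p) + A) X =
    frobenius P0 X + mu * quadform X p + frobenius A X.
  by rewrite !frobeniusDl frobeniusZl frobenius_rank1.
rewrite qxE qyE !FE.
have Hmu : mu * (quadform (hessian v x) p - quadform (hessian w y) p) <= - 4 * K * m.
  have -> : - 4 * K * m = mu * (- 8 * K * r ^+ 2).
    by rewrite /mu; field; rewrite gt_eqF.
  by rewrite ler_wpM2l// /mu divr_ge0 ?divr_ge0 ?sqr_ge0// ltW.
have crle : c * r <= 2 * K * del.
  by rewrite cr ler_wpM2l ?mulr_ge0// gerBl ltW.
(* Here c is large when r is small, but kap carries a factor r and c r <= 2 K del. *)
have H1 : c * (3 * d%:R * (kap * m)) <= K * m.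
  have -> : c * (3 * d%:R * (kap * m)) =
      3 * d%:R * (d%:R ^+ 3 * rho) * m * (c * r) by rewrite /kap; ring.
  apply: (@le_trans _ _ (3 * d%:R * (d%:R ^+ 3 * rho) * m * (2 * K * del))).
    by rewrite ler_wpM2l// !mulr_ge0 ?exprn_ge0 ?ler0n// ltW.
  have -> : 3 * d%:R * (d%:R ^+ 3 * rho) * m * (2 * K * del) =
      6 * d%:R * (d%:R ^+ 3 * rho) * del * (K * m) by ring.
  by rewrite ler_piMl// mulr_ge0// ltW.
have H2 : c * (k0 * r ^+ 2) <= K * eta0.
  have -> : c * (k0 * r ^+ 2) = c * r * (k0 * r) by ring.
  apply: (@le_trans _ _ (2 * K * del * (k0 * del))).
    rewrite ler_pM ?mulr_ge0 ?(ltW r_gt0)// ler_wpM2l//.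
  have -> : 2 * K * del * (k0 * del) = K * (2 * k0 * del ^+ 2) by ring.
  by rewrite ler_wpM2l.
have H3 : K * eta0 <= K * m by rewrite ler_wpM2l.
rewrite mulrBr in Hmu.
lra.
Qed.

End core.
End doubling_core.

(** * Euclidean norm, compactness and continuity *)

Section topology.
Variables (R : realType) (d : nat).

Lemma ler_mx_norm_enorm (u : 'rV[R]_d) : `|u| <= enorm u.
Proof.
rewrite [leLHS]/Num.Def.normr/= mx_normrE (bigmax_le _ (enorm_ge0 u))//= => -[i j] _.
by rewrite ord1; exact: ler_coord_enorm.
Qed.

Lemma ler_enorm_mx_norm (u : 'rV[R]_d) : enorm u <= d%:R * `|u|.
Proof.
rewrite -(ler_pXn2r (n := 2)) ?nnegrE ?mulr_ge0 ?ler0n ?enorm_ge0//.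
rewrite sqr_enorm exprMn (@le_trans _ _ (\sum_(i < d) `|u| ^+ 2))//.
  apply: ler_sum => i _; rewrite -expr2 -real_normK ?num_real//.
  rewrite ler_pXn2r ?nnegrE//.
  rewrite [leRHS]/Num.Def.normr/= mx_normrE.
  by apply/bigmax_geP; right => /=; exists (ord0, i).
rewrite sumr_const card_ord -[leLHS]mulr_natl ler_wpM2r ?sqr_ge0//.
by rewrite -natrX ler_nat; case: (d) => // n; rewrite leq_pmulr.
Qed.

Lemma continuous_enorm : continuous (@enorm R d).
Proof.
move=> x; apply/(@cvgrPdist_le _ _ _ (nbhs x)) => e e0.
have d1 : 0 < d%:R + 1 :> R by rewrite ltr_wpDl.
apply/nbhs_ballP; exists (e / (d%:R + 1)); first exact: divr_gt0.
move=> y; rewrite -ball_normE /ball_/= ltr_pdivlMr// => xy.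
have h u v : enorm (u : 'rV[R]_d) - enorm v <= enorm (u - v).
  by rewrite lerBlDr; apply: le_trans (ler_enormD _ _); rewrite subrK.
have : enorm (x - y) <= e.
  rewrite (le_trans (ler_enorm_mx_norm _))// (le_trans _ (ltW xy))//.
  by rewrite mulrC ler_wpM2l// lerDl.
rewrite ler_norml lerNl opprB => xye.
by apply/andP; split; rewrite (le_trans (h _ _))// -opprB enormN.
Qed.

Lemma compact_enorm_ball (N : R) : compact [set x : 'rV[R]_d | enorm x <= N].
Proof.
apply: bounded_closed_compact.
  exists N; split; first exact: num_real.
  move=> M NM x /= xN; rewrite (le_trans (ler_mx_norm_enorm _))//.
  by rewrite (le_trans xN) ?ltW.
apply: (@closed_comp _ _ (@enorm R d) [set y | y <= N]); last exact: closed_le.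
by move=> x _; exact: continuous_enorm.
Qed.

Lemma continuous_pair (T U V : topologicalType) (f : T -> U) (g : T -> V) :
  continuous f -> continuous g -> continuous (fun x => (f x, g x)).
Proof. by move=> cf cg x; apply: cvg_pair; [exact: cf|exact: cg]. Qed.

Lemma within_continuous_comp (T1 T2 U : topologicalType) (D : set T1) (S : set T2)
    (h : T1 -> T2) (F : T2 -> U) :
  continuous h -> (forall x, D x -> S (h x)) -> {within S, continuous F} ->
  {within D, continuous (fun x => F (h x))}.
Proof.
move=> ch DS /subspace_continuousP cF; apply/subspace_continuousP => x Dx.
apply: (@cvg_comp _ _ _ h F _ (within S (nbhs (h x)))); last exact/cF/DS.
move=> A SA; have := ch x _ SA; apply: (@filterS _ (nbhs x)) => z Az Dz.
by apply: Az; exact: DS.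
Qed.

(** The point p0 lies in K because F is non-negative there. A maximum over the compact set K [&] D
    is then non-negative, so it also dominates the values outside K. *)
Lemma EVT_max_negative_outside (T : topologicalType) (D K : set T) (F : T -> R)
    (p0 : T) : closed D -> compact K -> {within D, continuous F} ->
  (forall p, D p -> ~ K p -> F p < 0) -> D p0 -> 0 <= F p0 ->
  exists2 p, D p & F p0 <= F p /\ forall q, D q -> F q <= F p.
Proof.
move=> cD cK cF Fneg Dp0 Fp0.
have Kp0 : K p0 by apply: contrapT => /(Fneg _ Dp0); rewrite ltNge Fp0.
have cA : compact (K `&` D) by exact: compact_closedI.
have cFA : {within K `&` D, continuous F}.
  by apply: continuous_subspaceW cF => x [].
have [|p] := compact_EVT_max _ cA cFA; first by exists p0.
rewrite inE => -[Kp Dp] pmax; have p0p : F p0 <= F p by rewrite pmax// inE.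
exists p => //; split=> // q Dq; have [Kq|Kq] := pselect (K q).
  by rewrite pmax// inE.
by rewrite (le_trans (ltW (Fneg _ Dq Kq)))// (le_trans Fp0).
Qed.

Lemma continuous_time_slice (s t : R) (g : R -> 'rV[R]_d -> R) :
  {within `]s, +oo[%classic `*` setT, continuous (fun p => g p.1 p.2)} ->
  s < t -> continuous (g t).
Proof.
move=> cg st.
have cst : continuous (fun x : 'rV[R]_d => (t, x)).
  by apply: continuous_pair; [exact: cst_continuous|move=> x; exact: cvg_id].
have /subspace_continuousP H : {within [set: 'rV[R]_d], continuous (g t)}.
  apply: (within_continuous_comp cst _ cg) => x _.
  by split; rewrite //= in_itv/= andbT.
move=> x A /(H x I); apply: (@filterS _ (nbhs x)) => z; exact.
Qed.

Lemma is_C2_time_slice (s t : R) (u : R -> 'rV[R]_d -> R) :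
  is_C12 s u -> s < t -> is_C2 (u t).
Proof.
move=> [cu [dtu cdtu] du ddu] st; split=> [|i].
  split=> [|i]; first exact: continuous_time_slice cu st.
  have [dui cdui] := du i; split=> [x|]; first exact: dui.
  exact: (@continuous_time_slice s t (fun t => partial i (u t))).
split=> [|j].
  have [_ cdui] := du i.
  exact: (@continuous_time_slice s t (fun t => partial i (u t))).
have [d2u cd2u] := ddu j i; split=> [x|]; first exact: d2u.
exact: (@continuous_time_slice s t (fun t => partial j (partial i (u t)))).
Qed.

Lemma is_derive_expR_shift (lam s t : R) :
  is_derive t 1 (fun t => expR (lam * (t - s))) (lam * expR (lam * (t - s))).
Proof.
have h : is_derive t 1 (fun t => lam * (t - s)) lam.
  apply/is_derive_epsP => e e0; exists 1 => // h _.
  rewrite /GRing.scale/= (_ : _ - _ = 0); last by ring.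
  by rewrite normr0 mulr_ge0// ltW.
rewrite mulrC; exact: is_derive1_comp.
Qed.

(** Test along the gradient g itself: the derivative in the direction g is |g|^2, while the
    increment over a small step h is at most a h |g|. *)
Lemma ler_enorm_grad (f : 'rV[R]_d -> R) (a del : R) x : is_C1 f -> 0 <= a ->
  0 < del -> (forall x y, enorm (x - y) <= del -> f x - f y <= a * enorm (x - y)) ->
  enorm (grad f x) <= a.
Proof.
move=> C1f a0 del0 fa; set g := grad f x.
have [->|g0] := eqVneq g 0; first by rewrite enorm0.
have ng : 0 < enorm g by rewrite lt_def enorm_ge0 enorm_eq0 g0.
rewrite -(ler_pM2r ng) -expr2; apply/ler_addgt0Pr => e e0.
have /is_derive_epsP/(_ e e0)[r r0 H] := is_derive_C1 x g C1f.
pose h := Num.min (r / 2) (del / enorm g).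
have h0 : 0 < h by rewrite lt_min !divr_gt0.
have hr : `|h| < r.
  by rewrite gtr0_norm// gt_min; apply/orP; left; rewrite ltr_pdivrMr//; lra.
have hg : enorm (x + h *: g - x) = h * enorm g.
  by rewrite addrAC subrr add0r enormZ gtr0_norm.
have hdel : enorm (x + h *: g - x) <= del.
  by rewrite hg -ler_pdivlMr// ge_min lexx orbT.
have := fa _ _ hdel; have := H h hr.
rewrite hg ler_norml gtr0_norm// => /andP[+ _] fh.
rewrite -/g -sqr_enorm => H1.
rewrite -(ler_pM2l h0); lra.
Qed.

End topology.

(** * Maximum principles for bounded classical solutions *)

Section continuity.
Variables (R : realType) (T : topologicalType).
Implicit Types f g : T -> R.

Lemma continuous_addr f g :
  continuous f -> continuous g -> continuous (fun x => f x + g x).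
Proof. by move=> cf cg x; exact: (continuousD (cf x) (cg x)). Qed.

Lemma continuous_subr f g :
  continuous f -> continuous g -> continuous (fun x => f x - g x).
Proof. by move=> cf cg x; exact: (continuousB (cf x) (cg x)). Qed.

Lemma continuous_mulr f g :
  continuous f -> continuous g -> continuous (fun x => f x * g x).
Proof. by move=> cf cg x; exact: (continuousM (cf x) (cg x)). Qed.

Lemma continuous_comp_fun (U V : topologicalType) (h : T -> U) (k : U -> V) :
  continuous h -> continuous k -> continuous (fun x => k (h x)).
Proof. by move=> ch ck x; exact: (continuous_comp (ch x) (ck (h x))). Qed.

End continuity.

Section evolution.
Variables (R : realType) (d : nat).
Variables (Q : R -> 'rV[R]_d -> 'M[R]_d) (b : R -> 'rV[R]_d -> 'rV[R]_d).
Variables (s T : R) (phi : 'rV[R]_d -> R) (lam : R).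
Hypothesis lam_gt0 : 0 < lam.
Hypothesis C2phi : is_C2 phi.
Hypothesis phi_ge1 : forall x, 1 <= phi x.
Hypothesis phi_pinfty : tends_to_pinfty phi.
Hypothesis phi_lyapunov : forall t x, s < t <= T ->
  operatorA Q b t phi x <= lam * phi x.
Hypothesis symQ : forall t x, s < t <= T -> (Q t x)^T = Q t x.
Hypothesis psdQ : forall t x xi, s < t <= T -> 0 <= quadform (Q t x) xi.

Variables (f : 'rV[R]_d -> R) (u : R -> 'rV[R]_d -> R).
Hypothesis solu : bounded_classical_solution Q b s f u.

(** The rate lam + 1 exceeds the Lyapunov constant, so phi times [grow] is a strict supersolution;
    this strictness yields the contradictions below. *)
Let grow (t : R) : R := expR ((lam + 1) * (t - s)).

Let grow_gt0 t : 0 < grow t. Proof. exact: expR_gt0. Qed.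

Let continuous_grow : continuous grow.
Proof.
apply: (continuous_comp_fun _ (@continuous_expR R)).
apply: continuous_mulr; first exact: cst_continuous.
by apply: continuous_subr; [move=> x; exact: cvg_id|exact: cst_continuous].
Qed.

Let grow_ge1 t : s <= t -> 1 <= grow t.
Proof.
by move=> st; rewrite /grow -expR0 ler_expR mulr_ge0 ?subr_ge0// addr_ge0// ltW.
Qed.

Let phi_gt0 x : 0 < phi x. Proof. exact: lt_le_trans (phi_ge1 x). Qed.

Let continuous_phi : continuous phi. Proof. by case: C2phi => -[]. Qed.

Let u_bounded : exists2 B : R, 0 < B & forall t x, s <= t -> `|u t x| <= B.
Proof.
have [[_ [B [_ HB]]] _ _ _] := solu.
exists (`|B| + 1) => [|t x st]; first by rewrite ltr_wpDl.
apply: (HB (`|B| + 1) _ (t, x)) => /=.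
  by rewrite (le_lt_trans (ler_norm B))// ltrDl.
by split; rewrite //= in_itv/= andbT.
Qed.

Let u_initial x : u s x = f x. Proof. by case: solu. Qed.

Let C2u t : s < t -> is_C2 (u t).
Proof. by case: solu => _ C12 _ _; exact: is_C2_time_slice C12. Qed.

Let is_derive_u t x : s < t -> is_derive t 1 (u^~ x) (operatorA Q b t (u t) x).
Proof.
case: solu => _ [_ [du _] _ _] eq _ st; rewrite -eq// derive1E.
exact/derivableP/du.
Qed.

Let within_continuous_u (T' : topologicalType) (D : set T') (h : T' -> R * 'rV[R]_d) :
  continuous h -> (forall p, D p -> s <= (h p).1) ->
  {within D, continuous (fun p => u (h p).1 (h p).2)}.
Proof.
case: solu => -[cu _] _ _ _ ch hD.
apply: (within_continuous_comp ch _ cu) => p /hD sp.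
by split; rewrite //= in_itv/= andbT.
Qed.

Let phi_large N : exists r, forall x, ~ (enorm x <= r) -> N <= phi x.
Proof.
have [r Hr] := phi_pinfty N; exists r => x /negP; rewrite -ltNge => /ltW.
exact: Hr.
Qed.

Let is_derive_grow (t c : R) : is_derive t 1 (fun t => c * grow t) (c * ((lam + 1) * grow t)).
Proof. exact: (is_deriveZ c (is_derive_expR_shift (lam + 1) s t)). Qed.

(** A positive excess would survive subtraction of a small multiple of phi times [grow], and the
    maximum of the result would contradict the equation. The values 1 and -1 of [sg] give the upper
    and the lower bound. *)
Lemma weak_max_principle (sg M : R) : (forall x, sg * f x <= M) ->
  forall t x, s <= t <= T -> sg * u t x <= M.
Proof.
move=> fM t1 x1 /andP[st1 t1T]; rewrite leNgt; apply/negP => uM.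
have {}st1 : s < t1.
  rewrite lt_neqAle st1 andbT; apply/eqP => t1s.
  by have := fM x1; rewrite -u_initial t1s leNgt uM.
(* The penalty at (t1, x1) is half the excess, so F stays positive there. *)
pose eps := (sg * u t1 x1 - M) / (2 * (phi x1 * grow t1)).
have eps_gt0 : 0 < eps.
  by rewrite divr_gt0 ?subr_gt0// mulr_gt0// mulr_gt0.
pose F (p : R * 'rV[R]_d) := sg * u p.1 p.2 - (M + eps * phi p.2 * grow p.1).
pose D := (@fst R 'rV[R]_d) @^-1` `[s, t1]%classic.
have DE p : D p <-> s <= p.1 <= t1 by rewrite /D/= in_itv.
have [B B0 HB] := u_bounded.
(* Beyond radius r the penalty exceeds every possible value of sg u - M. *)
have [r Hr] := phi_large ((`|sg| * B + `|M| + 1) / eps).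
pose K := `[s, t1]%classic `*` [set x : 'rV[R]_d | enorm x <= r].
have cfst : continuous (@fst R 'rV[R]_d) by move=> p; exact: cvg_fst.
have csnd : continuous (@snd R 'rV[R]_d) by move=> p; exact: cvg_snd.
have clD : closed D.
  by apply: closed_comp => [p _|]; [exact: cfst|exact: itv_closed].
have cK : compact K.
  by apply: compact_setX; [exact: segment_compact|exact: compact_enorm_ball].
have cF : {within D, continuous F}.
  apply: continuous_subr.
    apply: continuous_mulr; first exact: cst_continuous.
    have := @within_continuous_u _ D id; apply; first by move=> p; exact: cvg_id.
    by move=> p /DE/andP[].
  apply: continuous_subspaceT; apply: continuous_addr; first exact: cst_continuous.
  apply: continuous_mulr; last exact: (continuous_comp_fun cfst continuous_grow).
  apply: continuous_mulr; first exact: cst_continuous.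
  exact: (continuous_comp_fun csnd continuous_phi).
have Fneg p : D p -> ~ K p -> F p < 0.
  move=> /DE/andP[sp pt] Kp; have /Hr : ~ (enorm p.2 <= r).
    by move=> pr; apply: Kp; split=> //=; rewrite in_itv/= sp.
  rewrite ler_pdivrMr// => large; rewrite subr_lt0.
  have h1 : sg * u p.1 p.2 <= `|sg| * B.
    by rewrite (le_trans (ler_norm _))// normrM ler_wpM2l// HB.
  have h2 : eps * phi p.2 * 1 <= eps * phi p.2 * grow p.1.
    by rewrite ler_wpM2l ?grow_ge1// mulr_ge0// ltW.
  have := ler_norm (- M); rewrite normrN; lra.
have F1 : 0 < F (t1, x1).
  rewrite /F/=; have -> : M + eps * phi x1 * grow t1 = (sg * u t1 x1 + M) / 2.
    rewrite /eps; field; rewrite (gt_eqF (phi_gt0 x1)) (gt_eqF (grow_gt0 t1))//.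
  lra.
have D1 : D (t1, x1) by apply/DE; rewrite lexx (ltW st1).
have [[t0 x0] /DE/= /andP[st0 t01]] := EVT_max_negative_outside clD cK cF Fneg D1 (ltW F1).
move=> [/(lt_le_trans F1) F0 Fmax].
have {}st0 : s < t0.
  rewrite lt_neqAle st0 andbT; apply/eqP => t0s; move: F0.
  rewrite /F/= -t0s u_initial ltNge lerBlDr add0r => /negP; apply.
  rewrite (le_trans (fM x0))// lerDl mulr_ge0 ?(ltW (grow_gt0 _))//.
  by rewrite mulr_ge0// ltW.
have t0T : s < t0 <= T by rewrite st0 (le_trans t01).
have time : 0 <= sg * operatorA Q b t0 (u t0) x0
    - eps * phi x0 * ((lam + 1) * grow t0).
  apply: (@derive_ge0_left_max R (fun t => sg * u t x0 - eps * phi x0 * grow t)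
    t0 _ (t0 - s)); last 2 first.
  - by rewrite subr_gt0.
  - move=> z; rewrite opprB addrC subrK => /andP[sz zt0].
    have := Fmax (z, x0); rewrite /F/= => H.
    suff : D (z, x0) by move=> /H; lra.
    by apply/DE; rewrite (ltW sz) (le_trans zt0).
  apply: is_deriveB; last exact: is_derive_grow.
  exact: (is_deriveZ sg (is_derive_u x0 st0)).
(* With this c, the function G = phi + c u is, up to a constant, a negative multiple of F at time
   t0, so x0 is a minimum of G. *)
pose c := - (sg / (eps * grow t0)).
have e0 : 0 < eps * grow t0 by rewrite mulr_gt0.
pose G x := phi x + c * u t0 x.
have C2G : is_C2 G by exact: (is_C2DZ c C2phi (C2u st0)).
have Gmin x : G x0 <= G x.
  have := Fmax (t0, x); rewrite /F/= => H.
  have {}H : sg * u t0 x - (M + eps * phi x * grow t0) <=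
      sg * u t0 x0 - (M + eps * phi x0 * grow t0).
    by apply: H; apply/DE; rewrite (ltW st0).
  have GE y : eps * grow t0 * G y = eps * phi y * grow t0 - sg * u t0 y.
    by rewrite /G /c; field; rewrite (gt_eqF eps_gt0) (gt_eqF (grow_gt0 t0)).
  by rewrite -(ler_pM2l e0) !GE; lra.
have var xi : dotrv xi (grad G x0) = 0 /\ 0 <= quadform (hessian G x0) xi.
  have d1 (z : R) := is_deriveN (is_derive_C1_line x0 xi z (proj1 C2G)).
  have d2 := is_deriveN (is_derive_C2_line0 x0 xi C2G).
  have [z _|] := second_derivative_test d1 d2 ltr01.
    by rewrite lerN2 scale0r addr0.
  by rewrite scale0r addr0 => /eqP; rewrite oppr_eq0 oppr_le0 => /eqP.
have : 0 <= operatorA Q b t0 G x0.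
  rewrite operatorA_frobenius (proj1 (var _)) addr0.
  apply: frobenius_psd_ge0 => [|xi|xi]; [exact: symQ|exact: psdQ|].
  exact: (proj2 (var xi)).
rewrite (operatorADZ Q b t0 c x0 C2phi (C2u st0)) -(pmulr_rge0 _ e0).
have -> : eps * grow t0 * (operatorA Q b t0 phi x0 + c * operatorA Q b t0 (u t0) x0)
    = eps * grow t0 * operatorA Q b t0 phi x0 - sg * operatorA Q b t0 (u t0) x0.
  rewrite /c; move: (operatorA _ _ _ _ _) (operatorA _ _ _ _ _) => p q.
  by field; rewrite (gt_eqF eps_gt0) (gt_eqF (grow_gt0 t0)).
have lyap : eps * grow t0 * operatorA Q b t0 phi x0 <= eps * grow t0 * (lam * phi x0).
  by rewrite ler_wpM2l ?(ltW e0)// phi_lyapunov.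
(* The time and space inequalities give lam + 1 <= lam after division by eps, [grow] and phi. *)
have := mulr_gt0 e0 (phi_gt0 x0).
move: time lyap; move: (operatorA _ _ _ _ _) (operatorA _ _ _ _ _) => p q.
lra.
Qed.

(** * Doubling of variables along a solution, giving the gradient bound at time tau *)

Section doubling_in_time.
Variables (et : R -> 'rV[R]_d -> R) (rho eta0 k0 : R).
Hypothesis C1q : forall t, s < t <= T -> forall i j, is_C1 (fun x => Q t x i j).
Hypothesis C1b : forall t, s < t <= T -> forall i, is_C1 (fun x => b t x 0 i).
Hypothesis ell : forall t, s < t <= T -> forall x xi,
  et t x * enorm xi ^+ 2 <= quadform (Q t x) xi.
Hypothesis etaP : forall t, s < t <= T -> forall x, eta0 <= et t x.
Hypothesis eta0_gt0 : 0 < eta0.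
Hypothesis diff : forall t, s < t <= T -> forall i j k x,
  `|partial k (fun y => Q t y i j) x| <= rho * et t x.
Hypothesis diss : forall t, s < t <= T -> forall x xi,
  quadform (jacobian_mx (b t) x) xi <= k0 * enorm xi ^+ 2.
Hypothesis rho_ge0 : 0 <= rho.
Hypothesis k0_ge0 : 0 <= k0.

Variables (tau del K c1 M : R).
Hypothesis tauT : s < tau <= T.
Hypothesis del_gt0 : 0 < del.
Hypothesis del_kap : d%:R ^+ 3 * rho * del <= 4^-1.
Hypothesis del_dkap : 6 * d%:R * (d%:R ^+ 3 * rho) * del <= 1.
Hypothesis del_k0 : 2 * k0 * del ^+ 2 <= eta0.
Hypothesis fM : forall x, `|f x| <= M.
Hypothesis KM : 2 * M <= K * del ^+ 2.
Hypothesis c1_ge0 : 0 <= c1.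
Hypothesis c1K : c1 < 2 * K * eta0.
Hypothesis f_incr : forall x y, enorm (x - y) <= del ->
  f x - f y <= 2 * K * del * enorm (x - y) - K * enorm (x - y) ^+ 2
    + c1 * (tau - s).

Let K_gt0 : 0 < K.
Proof.
have : 0 < K * eta0.
  by rewrite -(@pmulr_rgt0 _ 2)// mulrA (le_lt_trans c1_ge0).
by rewrite pmulr_lgt0.
Qed.

Let uM t x : s <= t <= T -> `|u t x| <= M.
Proof.
move=> tT; rewrite ler_norml; apply/andP; split.
  have := @weak_max_principle (-1) M _ t x tT; rewrite mulN1r lerNl; apply=> y.
  by rewrite mulN1r (le_trans (ler_norm _))// normrN.
have := @weak_max_principle 1 M _ t x tT; rewrite mul1r; apply=> y.
by rewrite mul1r (le_trans (ler_norm _)).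
Qed.

Let psi (r : R) := 2 * K * del * r - K * r ^+ 2.

Let psi_ge0 r : 0 <= r <= del -> 0 <= psi r.
Proof.
move=> /andP[r0 rdel]; have -> : psi r = K * (r * (2 * del - r)) by rewrite /psi; ring.
by rewrite mulr_ge0 ?(ltW K_gt0)// mulr_ge0//; lra.
Qed.

Lemma increment_bound x y : enorm (x - y) <= del ->
  u tau x - u tau y <= 2 * K * del * enorm (x - y).
Proof.
have [stau tau_T] := andP tauT.
suff H x1 y1 : enorm (x1 - y1) <= del ->
    u tau x1 - u tau y1 <= psi (enorm (x1 - y1)).
  move=> /H/le_trans; apply; rewrite /psi gerBl.
  by rewrite mulr_ge0 ?sqr_ge0 ?(ltW K_gt0).
move=> xy1; rewrite leNgt; apply/negP => uxy1.
(* As before, the penalty takes half the assumed excess. *)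
pose eps := (u tau x1 - u tau y1 - psi (enorm (x1 - y1)))
  / (2 * ((phi x1 + phi y1) * grow tau)).
have phi2 : 0 < phi x1 + phi y1 by rewrite addr_gt0.
have eps_gt0 : 0 < eps.
  by rewrite divr_gt0 ?subr_gt0// mulr_gt0// mulr_gt0.
pose F (p : R * ('rV[R]_d * 'rV[R]_d)) := u p.1 p.2.1 - u p.1 p.2.2 -
  (psi (enorm (p.2.1 - p.2.2)) + c1 * (tau - p.1)
   + eps * (phi p.2.1 + phi p.2.2) * grow p.1).
pose V := (R * ('rV[R]_d * 'rV[R]_d))%type.
have cfst : continuous (fun p : V => p.1) by move=> p; exact: cvg_fst.
have csnd : continuous (fun p : V => p.2) by move=> p; exact: cvg_snd.
have cx : continuous (fun p : V => p.2.1).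
  by apply: (continuous_comp_fun csnd) => p; exact: cvg_fst.
have cy : continuous (fun p : V => p.2.2).
  by apply: (continuous_comp_fun csnd) => p; exact: cvg_snd.
have cdist : continuous (fun p : V => enorm (p.2.1 - p.2.2)).
  apply: (continuous_comp_fun _ (@continuous_enorm R d)) => p.
  exact: (continuousB (cx p) (cy p)).
pose D := (fun p : V => p.1) @^-1` `[s, tau]%classic `&`
  (fun p : V => enorm (p.2.1 - p.2.2)) @^-1` [set r | r <= del].
have DE p : D p <-> s <= p.1 <= tau /\ enorm (p.2.1 - p.2.2) <= del.
  by rewrite /D/= in_itv.
have [r Hr] := phi_large ((2 * M + 1) / eps).
pose B := [set x : 'rV[R]_d | enorm x <= r].
pose K' := `[s, tau]%classic `*` (B `*` B).
have clD : closed D.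
  apply: closedI; apply: closed_comp.
  - by move=> p _; exact: cfst.
  - exact: itv_closed.
  - by move=> p _; exact: cdist.
  - exact: closed_le.
have cK : compact K'.
  apply: compact_setX; first exact: segment_compact.
  by apply: compact_setX; exact: compact_enorm_ball.
have cF : {within D, continuous F}.
  apply: continuous_subr.
    apply: continuous_subr.
      apply: (within_continuous_u (h := fun p : V => (p.1, p.2.1))).
        exact: continuous_pair.
      by move=> p /DE[/andP[]].
    apply: (within_continuous_u (h := fun p : V => (p.1, p.2.2))).
      exact: continuous_pair.
    by move=> p /DE[/andP[]].
  apply: continuous_subspaceT; apply: continuous_addr.
    apply: continuous_addr.
      apply: continuous_subr; apply: continuous_mulr; do ?[exact: cst_continuous|exact: cdist].
      by apply: continuous_mulr.
    apply: continuous_mulr; first exact: cst_continuous.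
    by apply: continuous_subr; first exact: cst_continuous.
  apply: continuous_mulr; last exact: (continuous_comp_fun cfst continuous_grow).
  apply: continuous_mulr; first exact: cst_continuous.
  apply: continuous_addr; first exact: (continuous_comp_fun cx continuous_phi).
  exact: (continuous_comp_fun cy continuous_phi).
(* Where F is non-negative, the penalty is controlled by the oscillation 2 M of u. The initial time
   is excluded by [f_incr], the diagonal because the difference of u vanishes, and distance del
   because psi(del) = K del^2 >= 2 M. *)
have Fpos p : D p -> 0 <= F p ->
    [/\ eps * (phi p.2.1 + phi p.2.2) * grow p.1 <= 2 * M,
      s < p.1, p.2.1 != p.2.2 & enorm (p.2.1 - p.2.2) < del].
  move=> /DE[/andP[sp ptau] pdel]; rewrite /F subr_ge0 => Fp.
  have psi0 : 0 <= psi (enorm (p.2.1 - p.2.2)).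
    by apply: psi_ge0; rewrite enorm_ge0.
  have c10 : 0 <= c1 * (tau - p.1) by rewrite mulr_ge0// subr_ge0.
  have e0 : 0 < eps * (phi p.2.1 + phi p.2.2) * grow p.1.
    by rewrite mulr_gt0// mulr_gt0// addr_gt0.
  have spT : s <= p.1 <= T by rewrite sp (le_trans ptau).
  have u2 : u p.1 p.2.1 - u p.1 p.2.2 <= 2 * M.
    have := uM p.2.1 spT; have := uM p.2.2 spT; rewrite !ler_norml.
    by move=> /andP[? ?] /andP[? ?]; lra.
  split; first lra.
  - rewrite lt_neqAle sp andbT; apply/eqP => ps.
    have := f_incr pdel; move: Fp psi0 c10 e0 u2; rewrite -ps !u_initial /psi; lra.
  - apply/eqP => pxy; move: Fp psi0 c10 e0 u2; rewrite pxy !subrr; lra.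
  - rewrite lt_neqAle pdel andbT; apply/eqP => pE.
    move: Fp psi0; rewrite pE /psi => Fp psi0.
    have : 2 * K * del * del - K * del ^+ 2 = K * del ^+ 2 by ring.
    move: KM u2 c10 e0; lra.
have Fneg p : D p -> ~ K' p -> F p < 0.
  move=> Dp Kp; rewrite ltNge; apply/negP => Fp.
  have [large _ _ _] := Fpos p Dp Fp.
  have /DE[/andP[sp ptau] pdel] := Dp.
  (* Outside K' at least one of the two points leaves the ball, and its phi alone makes the sum
     large since the other is positive. *)
  have : 2 * M + 1 <= eps * (phi p.2.1 + phi p.2.2).
    have [xr|/Hr xr] := pselect (enorm p.2.1 <= r); last first.
      rewrite ler_pdivrMr// in xr.
      by have := mulr_gt0 eps_gt0 (phi_gt0 p.2.2); lra.
    have [yr|/Hr yr] := pselect (enorm p.2.2 <= r); last first.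
      rewrite ler_pdivrMr// in yr.
      by have := mulr_gt0 eps_gt0 (phi_gt0 p.2.1); lra.
    by exfalso; apply: Kp; split=> //=; rewrite in_itv/= sp.
  have h2 : eps * (phi p.2.1 + phi p.2.2) * 1 <= eps * (phi p.2.1 + phi p.2.2) * grow p.1.
    by rewrite ler_wpM2l ?grow_ge1// ltW// mulr_gt0// addr_gt0.
  by move: large; lra.
have F1 : 0 < F (tau, (x1, y1)).
  rewrite /F/= subrr mulr0 addr0.
  have -> : eps * (phi x1 + phi y1) * grow tau =
      (u tau x1 - u tau y1 - psi (enorm (x1 - y1))) / 2.
    by rewrite /eps; field; rewrite (gt_eqF phi2) (gt_eqF (grow_gt0 tau)).
  lra.
have D1 : D (tau, (x1, y1)) by apply/DE; rewrite /= lexx (ltW stau).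
have [[t0 [x0 y0]] D0 [F10 Fmax]] := EVT_max_negative_outside clD cK cF Fneg D1 (ltW F1).
have F0 := lt_le_trans F1 F10.
have [_ /= st0 xy0 xydel] := Fpos _ D0 (ltW F0).
have /DE/=[/andP[_ t0tau] _] := D0.
have t0T : s < t0 <= T by rewrite st0 (le_trans t0tau).
have time : 0 <= operatorA Q b t0 (u t0) x0 - operatorA Q b t0 (u t0) y0 + c1
    - eps * (phi x0 + phi y0) * ((lam + 1) * grow t0).
  apply: (@derive_ge0_left_max R (fun t => u t x0 - u t y0 + c1 * t
    - eps * (phi x0 + phi y0) * grow t) t0 _ (t0 - s)); last 2 first.
  - by rewrite subr_gt0.
  - move=> z; rewrite opprB addrC subrK => /andP[sz zt0].
    have := Fmax (z, (x0, y0)); rewrite /F/= => H.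
    suff : D (z, (x0, y0)) by move=> /H; lra.
    by apply/DE; rewrite /= (ltW xydel) (ltW sz) (le_trans zt0).
  apply: is_deriveB; last exact: is_derive_grow.
  apply: is_deriveD; first exact: (is_deriveB (is_derive_u x0 st0) (is_derive_u y0 st0)).
  apply/is_derive_epsP => e e0; exists 1 => // h _.
  rewrite /GRing.scale/= (_ : _ - _ = 0); last by ring.
  by rewrite normr0 mulr_ge0// ltW.
have e0 : 0 < eps * grow t0 by rewrite mulr_gt0.
(* The penalty is shared between the two points, with opposite signs because w enters negatively: v
   x - w y - psi is F at time t0 up to a constant. *)
pose v x := u t0 x + (- (eps * grow t0)) * phi x.
pose w x := u t0 x + (eps * grow t0) * phi x.
have vw_max x' y' : enorm (x' - y') <= del ->
    v x' - w y' - psi (enorm (x' - y')) <= v x0 - w y0 - psi (enorm (x0 - y0)).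
  move=> xy'; have := Fmax (t0, (x', y')); rewrite /F/= => H.
  suff : D (t0, (x', y')) by move=> /H; rewrite /v /w; lra.
  by apply/DE; rewrite /= (ltW st0).
have := doubling_operator_bound (C1q t0T) (C1b t0T) (fun x => symQ x t0T)
  (ell t0T) (etaP t0T) eta0_gt0 (diff t0T) (diss t0T) rho_ge0 k0_ge0
  (ltW K_gt0) del_kap del_dkap del_k0 (is_C2DZ _ (C2u st0) C2phi)
  (is_C2DZ _ (C2u st0) C2phi) xy0 xydel vw_max.
rewrite -!operatorA_frobenius !(operatorADZ Q b t0 _ _ (C2u st0) C2phi).
have lx : eps * grow t0 * operatorA Q b t0 phi x0 <= eps * grow t0 * (lam * phi x0).
  by rewrite ler_wpM2l ?(ltW e0)// phi_lyapunov.
have ly : eps * grow t0 * operatorA Q b t0 phi y0 <= eps * grow t0 * (lam * phi y0).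
  by rewrite ler_wpM2l ?(ltW e0)// phi_lyapunov.
(* The gain 2 K eta0 outweighs c1, and the extra rate 1 of [grow] absorbs the Lyapunov terms. *)
have := mulr_gt0 e0 (phi_gt0 x0); have := mulr_gt0 e0 (phi_gt0 y0).
move: time lx ly c1K.
move: (operatorA Q b t0 (u t0) x0) (operatorA Q b t0 (u t0) y0) => p1 p2.
move: (operatorA Q b t0 phi x0) (operatorA Q b t0 phi y0) => p3 p4.
lra.
Qed.

Lemma gradient_bound x : enorm (grad (u tau) x) <= 2 * K * del.
Proof.
apply: (ler_enorm_grad _ (proj1 (C2u (proj1 (andP tauT)))) _ del_gt0 increment_bound).
by rewrite !mulr_ge0 ?(ltW K_gt0) ?(ltW del_gt0).
Qed.

End doubling_in_time.

End evolution.

(** * The standing assumptions *)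

Section standing_assumptions.
Variables (R : realType) (d : nat).

Lemma is_C2_cst (c : R) : is_C2 (fun _ : 'rV[R]_d => c).
Proof.
have part0 (e : R) i : partial i (fun _ : 'rV[R]_d => e) = fun=> 0.
  by apply/funext => x; exact: derive_cst.
have C1 (e : R) : is_C1 (fun _ : 'rV[R]_d => e).
  split=> [|i]; first exact: cst_continuous.
  split=> [x|]; first exact: derivable_cst.
  by rewrite part0; exact: cst_continuous.
by split=> [|i]; [exact: C1|rewrite part0; exact: C1].
Qed.

Lemma operatorA_cst Q b (t c : R) (x : 'rV[R]_d) :
  operatorA Q b t (fun=> c) x = 0.
Proof.
have part0 (e : R) i : partial i (fun _ : 'rV[R]_d => e) = fun=> 0.
  by apply/funext => y; exact: derive_cst.
rewrite /operatorA big1 => [|i _]; last first.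
  by rewrite big1// => j _; rewrite !part0 mulr0.
by rewrite add0r big1// => i _; rewrite part0 mulr0.
Qed.

Lemma tends_to_pinfty_lbound (phi : 'rV[R]_d -> R) :
  continuous phi -> tends_to_pinfty phi -> exists m, forall x, m <= phi x.
Proof.
move=> cphi /(_ 0)[r Hr]; pose B := [set x : 'rV[R]_d | enorm x <= `|r|].
have cphiB : {within B, continuous phi} by exact: continuous_subspaceT.
have [|c _ Hc] := compact_EVT_min _ (@compact_enorm_ball R d `|r|) cphiB.
  by exists 0; rewrite /B/= enorm0.
exists (Num.min 0 (phi c)) => x; rewrite ge_min.
have [xr|xr] := leP (enorm x) `|r|; first by rewrite Hc ?orbT// inE.
by rewrite Hr// (le_trans (ler_norm _))// ltW.
Qed.

(** Normalisation: phi is bounded below, the operator kills constants, and lam > 0, so adding a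
    large positive constant preserves the Lyapunov inequality. *)
Lemma lyapunov_ge1 (I J : set R) (Q : R -> 'rV[R]_d -> 'M[R]_d) b :
  lyapunov I Q b -> is_interval J -> bounded_set J -> J `<=` I ->
  exists (phi : 'rV[R]_d -> R) (lam : R),
    [/\ 0 < lam, is_C2 phi, forall x, 1 <= phi x, tends_to_pinfty phi &
        forall t x, J t -> operatorA Q b t phi x <= lam * phi x].
Proof.
move=> lyap iJ bJ JI; have [phi [lam [C2phi lam0 phioo Aphi]]] := lyap J iJ bJ JI.
have [m Hm] := tends_to_pinfty_lbound (proj1 (proj1 C2phi)) phioo.
pose c := `|m| + 1; have c0 : 0 <= c by rewrite addr_ge0.
exists (fun x => phi x + c * 1), lam; split.
- exact: lam0.
- exact: (is_C2DZ c C2phi (is_C2_cst 1)).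
- by move=> x; have := Hm x; have := ler_norm (- m); rewrite normrN /c; lra.
- by move=> M; have [r Hr] := phioo M; exists r => x /Hr; lra.
- move=> t x Jt; rewrite (operatorADZ Q b t c x C2phi (is_C2_cst 1)).
  rewrite operatorA_cst mulr0 addr0; have := Aphi t x Jt.
  rewrite subr_le0 => /le_trans; apply.
  by rewrite ler_wpM2l ?(ltW lam0)//; lra.
Qed.

(** On the compact set consisting of a closed ball at the single time t, the parabolic distance is
    the Euclidean one. *)
Lemma continuous_loc_parabolic_holder (I : set R) (alpha t : R)
    (g : R -> 'rV[R]_d -> R) :
  0 < alpha -> loc_parabolic_holder I alpha g -> I t -> continuous (g t).
Proof.
move=> alpha0 holder It x.
pose K := [set t] `*` [set y : 'rV[R]_d | enorm y <= enorm x + 1].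
have cK : compact K.
  by apply: compact_setX; [exact: compact_set1|exact: compact_enorm_ball].
have [|C HC] := holder K cK; first by move=> p [/= -> _].
have C1 : 0 < `|C| + 1 by rewrite ltr_wpDl.
apply/(@cvgrPdist_le _ _ _ (nbhs x)) => e e0.
(* The second bound solves (|C| + 1) r^alpha = e; the bound 1 keeps y in the ball where C is
   valid. *)
pose r := Num.min 1 ((e / (`|C| + 1)) `^ alpha^-1).
have r0 : 0 < r by rewrite lt_min ltr01 powR_gt0// divr_gt0.
have d1 : 0 < d%:R + 1 :> R by rewrite ltr_wpDl.
apply/nbhs_ballP; exists (r / (d%:R + 1)); first exact: divr_gt0.
move=> y; rewrite -ball_normE /ball_/= ltr_pdivlMr// => xy.
have {xy} : enorm (x - y) <= r.
  rewrite (le_trans (ler_enorm_mx_norm _))// (le_trans _ (ltW xy))//.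
  by rewrite mulrC ler_wpM2l// lerDl.
rewrite le_min => /andP[xy1 xye].
have yx : enorm y <= enorm x + 1.
  have -> : y = x + - (x - y) by rewrite opprB addrC subrK.
  by rewrite (le_trans (ler_enormD _ _))// enormN lerD2l.
have := HC (t, x) (t, y); rewrite /parabolic_dist/= subrr normr0 sqrtr0 addr0.
move=> h; apply: (le_trans (h _ _)).
- by split=> //=; rewrite lerDl.
- by [].
apply: (@le_trans _ _ ((`|C| + 1) * (e / (`|C| + 1)))); last first.
  by rewrite mulrC divfK// gt_eqF.
rewrite (@le_trans _ _ (`|C| * enorm (x - y) `^ alpha))//.
  by rewrite ler_wpM2r ?powR_ge0// ler_norm.
rewrite ler_pM ?powR_ge0// ?lerDl//.
have -> : e / (`|C| + 1) = ((e / (`|C| + 1)) `^ alpha^-1) `^ alpha.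
  by rewrite -powRrM mulVf ?gt_eqF// powRr1// ltW// divr_gt0.
apply: ge0_ler_powR; rewrite ?nnegrE ?enorm_ge0 ?powR_ge0//.
exact: ltW.
Qed.

Lemma is_C1_holder_with_gradient (I : set R) (alpha t : R)
    (g : R -> 'rV[R]_d -> R) :
  0 < alpha -> holder_with_gradient I alpha g -> I t -> is_C1 (g t).
Proof.
move=> alpha0 [hg dg] It; split.
  exact: continuous_loc_parabolic_holder hg It.
move=> i; have [dgi hdgi] := dg i; split=> [x|]; first exact: dgi.
exact: (@continuous_loc_parabolic_holder I alpha t (fun t => partial i (g t))).
Qed.

Lemma within_continuous_ubound (I : set R) (k : R -> R) (s T : R) :
  s <= T -> `[s, T]%classic `<=` I -> {within I, continuous k} ->
  exists2 k0, 0 <= k0 & forall t, s <= t <= T -> k t <= k0.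
Proof.
move=> sT sTI ck.
have [c _ Hc] := EVT_max sT (continuous_subspaceW sTI ck).
by exists `|k c| => // t tT; rewrite (le_trans _ (ler_norm _))// Hc.
Qed.

Lemma supnorm_bounded (g : 'rV[R]_d -> R) : bounded_fun g ->
  exists B, [/\ supnorm g = B%:E, 0 <= B & forall x, `|g x| <= B].
Proof.
move=> [M [_ HM]].
have le_sup x : (`|g x|%:E <= supnorm g)%E.
  by apply: ereal_sup_ubound; exists x.
have sup_le : (supnorm g <= (`|M| + 1)%:E)%E.
  apply: ge_ereal_sup => _ [x _ <-]; rewrite lee_fin.
  by apply: HM => //; rewrite (le_lt_trans (ler_norm M))// ltrDl.
have sup_ge0 : (0 <= supnorm g)%E by apply: le_trans (le_sup 0); rewrite lee_fin.
have sup_fin : supnorm g \is a fin_num.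
  by rewrite ge0_fin_numE//; exact: le_lt_trans sup_le (ltry _).
exists (fine (supnorm g)); split; first by rewrite fineK.
  by rewrite -lee_fin fineK.
by move=> x; rewrite -lee_fin fineK.
Qed.

Lemma ler_increment_partial (g : 'rV[R]_d -> R) (B : 'I_d -> R) x y :
  is_C1 g -> (forall i x, `|partial i g x| <= B i) ->
  g x - g y <= (\sum_i B i) * enorm (x - y).
Proof.
move=> C1g HB.
have [c _] := MVT_line y 1 (fun z => is_derive_C1 z (x - y) C1g).
rewrite scale1r mul1r [y + _]addrC subrK => ->; rewrite dotrv_row mulr_suml.
apply: ler_sum => i _; rewrite (le_trans (ler_norm _))// normrM mulrC.
by rewrite ler_pM// ler_coord_enorm.
Qed.

Lemma evolG_cases Q b (t s : R) (f : 'rV[R]_d -> R) : s < t ->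
  evolG Q b t s f = (fun=> 0) \/
  exists2 u, bounded_classical_solution Q b s f u & evolG Q b t s f = u t.
Proof.
move=> st; rewrite /evolG gt_eqF//; case: xgetP => [u ? solu|_]; last by left.
by right; exists u.
Qed.

Lemma grad_supnorm_le (g : 'rV[R]_d -> R) (C : R) :
  (forall x, enorm (grad g x) <= C) -> (grad_supnorm g <= C%:E)%E.
Proof. by move=> gC; apply: ge_ereal_sup => _ [x _ <-]; rewrite lee_fin. Qed.

Lemma grad_cst (c : R) (x : 'rV[R]_d) : grad (fun=> c) x = 0.
Proof. by apply/rowP => i; rewrite !mxE; exact: derive_cst. Qed.

End standing_assumptions.

(** * Choice of the constants and the two gradient estimates *)

Theorem theorem4p1 (R : realType) (d : nat) (hd : (1 <= d)%N)
  (I : set R) (hI : full_or_right_halfline I)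
  (alpha : R) (halpha : 0 < alpha < 1)
  (Q : R -> 'rV[R]_d -> 'M[R]_d) (b : R -> 'rV[R]_d -> 'rV[R]_d)
  (eta : R -> 'rV[R]_d -> R)
  (hregular : regular_coefficients I alpha Q b)
  (helliptic : elliptic I Q eta)
  (hlyapunov : lyapunov I Q b)
  (hdrift : drift_dissipative I b)
  (hdiffusion : diffusion_gradient_bound I Q eta)
  (s T : R) (hs : I s) (hT : s < T) :
  exists C1 C2 : R,
    [/\ 0 < C1,
        0 < C2,
        (forall f : 'rV[R]_d -> R, is_C1b f ->
           forall t : R, s < t <= T ->
             (grad_supnorm (evolG Q b t s f) <= C1%:E * C1b_norm f)%E) &
        (forall f : 'rV[R]_d -> R, is_Cb f ->
           forall t : R, s < t <= T ->
             (grad_supnorm (evolG Q b t s f)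
                <= (C2 / Num.sqrt (t - s))%:E * supnorm f)%E)].
Proof.
have sTI : `[s, T]%classic `<=` I.
  case: hI hs => [-> //|[a [->|->]]] /=; rewrite in_itv/= andbT => sa t /=;
    rewrite !in_itv/= andbT => /andP[st _]; [exact: lt_le_trans st|exact: le_trans st].
have It t : s < t <= T -> I t.
  by move=> /andP[st tT]; apply: sTI; rewrite /= in_itv/= (ltW st).
have alpha0 : 0 < alpha by case/andP: halpha.
have [hQ hb] := hregular.
have C1q t : s < t <= T -> forall i j, is_C1 (fun x => Q t x i j).
  by move=> /It tI i j; exact: (is_C1_holder_with_gradient alpha0 (hQ i j) tI).
have C1b t : s < t <= T -> forall i, is_C1 (fun x => b t x 0 i).
  by move=> /It tI i; exact: (is_C1_holder_with_gradient alpha0 (hb i) tI).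
have [symQ inf_gt0 ellQ] := helliptic.
pose S := [set (eta p.1 p.2)%:E | p in I `*` [set: 'rV[R]_d]].
have inf_le t x : I t -> (ereal_inf S <= (eta t x)%:E)%E.
  by move=> tI; apply: ereal_inf_lbound; exists (t, x).
have inf_fin : ereal_inf S \is a fin_num.
  by rewrite ge0_fin_numE ?ltW//; exact: le_lt_trans (inf_le s 0 hs) (ltry _).
pose eta0 := fine (ereal_inf S).
have eta0_gt0 : 0 < eta0 by rewrite -lte_fin fineK.
have etaP t : I t -> forall x, eta0 <= eta t x.
  by move=> tI x; rewrite -lee_fin fineK// inf_le.
have [k [ck Hk]] := hdrift.
have [k0 k0_ge0 kk0] := within_continuous_ubound (ltW hT) sTI ck.
have [rho [crho rho_ge0 Hrho]] := hdiffusion.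
have [r0 r0_ge0 rr0] := within_continuous_ubound (ltW hT) sTI crho.
have sT_ge0 t : s < t <= T -> s <= t <= T by move=> /andP[/ltW -> ->].
have diss t : s < t <= T -> forall x xi,
    quadform (jacobian_mx (b t) x) xi <= k0 * enorm xi ^+ 2.
  move=> tT x xi; rewrite (le_trans (Hk t x xi (It t tT)))//.
  by rewrite ler_wpM2r ?sqr_ge0// kk0// sT_ge0.
have diff t : s < t <= T -> forall i j l x,
    `|partial l (fun y => Q t y i j) x| <= r0 * eta t x.
  move=> tT i j l x; rewrite (le_trans (Hrho i j l t x (It t tT)))//.
  rewrite ler_wpM2r ?rr0 ?sT_ge0//.
  by rewrite (le_trans (ltW eta0_gt0))// etaP//; exact: It.
have psdQ t x xi : s < t <= T -> 0 <= quadform (Q t x) xi.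
  move=> /It tI; apply: le_trans (ellQ t x xi tI).
  by rewrite mulr_ge0 ?sqr_ge0// (le_trans (ltW eta0_gt0))// etaP.
have [|phi [lam [lam0 C2phi phi1 phioo Aphi]]] :=
    lyapunov_ge1 hlyapunov (@interval_is_interval R `[s, T]) _ sTI.
  exact/compact_bounded/segment_compact.
pose kap : R := d%:R ^+ 3 * r0.
have kap_ge0 : 0 <= kap by rewrite mulr_ge0// exprn_ge0// ler0n.
(* One summand for each smallness condition on del, so that del <= 1/N ensures all of them; the
   summand 1 gives del <= 1, which reduces del^2 to del in the drift condition. *)
pose N : R := 1 + 4 * kap + 6 * d%:R * kap + 2 * k0 / eta0.
have dkap : 0 <= 6 * d%:R * kap by rewrite !mulr_ge0// ler0n.
have k0eta0 : 0 <= 2 * k0 / eta0 by rewrite divr_ge0 ?mulr_ge0// ltW.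
have N1 : 1 <= N by rewrite /N; lra.
have N0 : 0 < N := lt_le_trans ltr01 N1.
have key f u tau del K c1 M : bounded_classical_solution Q b s f u ->
    s < tau <= T -> 0 < del -> del <= N^-1 -> (forall x, `|f x| <= M) ->
    2 * M <= K * del ^+ 2 -> 0 <= c1 -> c1 < 2 * K * eta0 ->
    (forall x y, enorm (x - y) <= del ->
      f x - f y <= 2 * K * del * enorm (x - y) - K * enorm (x - y) ^+ 2
        + c1 * (tau - s)) ->
    forall x, enorm (grad (u tau) x) <= 2 * K * del.
  move=> solu tauT del0 delN.
  have delN1 : del * N <= 1 by rewrite -ler_pdivlMr// mul1r.
  have [del1 h1 h2 h3] : [/\ del <= 1, kap * del <= 4^-1,
      6 * d%:R * kap * del <= 1 & 2 * k0 / eta0 * del <= 1].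
    move: delN1; rewrite /N !mulrDr mulr1.
    have := mulr_ge0 (ltW del0) kap_ge0; have := mulr_ge0 (ltW del0) dkap.
    have := mulr_ge0 (ltW del0) k0eta0.
    move: (6 * d%:R * kap) (2 * k0 / eta0) => A B.
    by move=> *; split; lra.
  have h4 : 2 * k0 * del ^+ 2 <= eta0.
    rewrite mulrAC ler_pdivrMr// mul1r in h3; apply: le_trans h3.
    by rewrite ler_wpM2l ?mulr_ge0// expr2 ler_piMl// ltW.
  apply: (gradient_bound lam0 C2phi phi1 phioo _ _ psdQ solu C1q C1b _ _ eta0_gt0
    diff diss r0_ge0 k0_ge0 tauT del0 h1 h2 h4).
  - by move=> t x tT; apply: Aphi; rewrite /= in_itv/= sT_ge0.
  - by move=> t x /It; exact: symQ.
  - by move=> t /It tI x xi; exact: ellQ.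
  - by move=> t /It; exact: etaP.
(* For (ii), del = z sqrt(t - s). The first bound gives del <= 1/N up to time T; the second gives
   z^2 <= eta0, so that c1 = K z^2 stays below 2 K eta0. *)
pose z := Num.min (N^-1 / Num.sqrt (T - s)) (Num.sqrt eta0).
have sqT : 0 < Num.sqrt (T - s) by rewrite sqrtr_gt0 subr_gt0.
have z0 : 0 < z by rewrite lt_min divr_gt0 ?invr_gt0//= sqrtr_gt0.
exists (4 * N), (4 / z); split.
- by rewrite mulr_gt0.
- by rewrite divr_gt0.
- move=> f [C1f bf bdf] t tT; have [st _] := andP tT; rewrite /C1b_norm.
  have [B [-> B0 HB]] := supnorm_bounded bf.
  have /choice[L HL] := fun i => supnorm_bounded (bdf i).
  have L0 i : 0 <= L i by case: (HL i).
  have -> : (\sum_(i < d) supnorm (partial i f))%E = (\sum_(i < d) L i)%:E.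
    by rewrite -sumEFin; apply: eq_bigr => i _; case: (HL i).
  set L1 := \sum_i L i; have L10 : 0 <= L1 by exact: sumr_ge0.
  have f_lip x y : f x - f y <= L1 * enorm (x - y).
    by apply: ler_increment_partial => // i w; case: (HL i).
  rewrite -EFinD -EFinM; apply: grad_supnorm_le => x.
  case: (evolG_cases Q b f st) => [->|[u solu ->]].
    by rewrite grad_cst enorm0 mulr_ge0 ?addr_ge0// mulr_ge0// ltW.
  apply/ler_addgt0Pr => e e0.
  (* The added term keeps M and K positive even for f = 0 and contributes exactly e to the final
     bound. *)
  pose M := B + e / (4 * N); have M0 : 0 < M by rewrite ltr_wpDl// divr_gt0// mulr_gt0.
  (* With del = 1/N this gives K del^2 >= 2 M and K del >= L1, and 2 K del = 2 N (2 M + L1) is the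
     source of 4 N. *)
  pose K := (2 * M + L1) * N ^+ 2.
  have ML : 0 < 2 * M + L1 by rewrite ltr_wpDr// mulr_gt0.
  have K0 : 0 < K by rewrite mulr_gt0// exprn_gt0.
  have KN : K * N^-1 = (2 * M + L1) * N by rewrite /K; field; rewrite gt_eqF.
  have KN2 : K * N^-1 ^+ 2 = 2 * M + L1 by rewrite /K; field; rewrite gt_eqF.
  apply: (@le_trans _ _ (2 * K * N^-1)); last first.
    rewrite -mulrA KN /M; have -> : 2 * ((2 * (B + e / (4 * N)) + L1) * N) =
      4 * N * B + e + 2 * N * L1 by field; rewrite gt_eqF.
    by have := mulr_ge0 (ltW N0) L10; lra.
  apply: (key f u t N^-1 K 0 M solu tT); rewrite ?invr_gt0//.
  - by move=> y; rewrite (le_trans (HB y))// /M lerDl ltW// divr_gt0// mulr_gt0.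
  - by rewrite KN2 lerDl.
  - by rewrite mulr_gt0// mulr_gt0.
  - move=> y w yw; rewrite mul0r addr0 (le_trans (f_lip y w))//.
    have -> : 2 * K * N^-1 * enorm (y - w) - K * enorm (y - w) ^+ 2 =
      K * (2 * N^-1 - enorm (y - w)) * enorm (y - w) by ring.
    (* For r <= 1/N one has 2/N - r >= 1/N, so psi(r) >= (K/N) r, which dominates the Lipschitz
       bound L1 r of f. *)
    rewrite ler_wpM2r ?enorm_ge0// (@le_trans _ _ (K * N^-1))//; last first.
      by rewrite ler_wpM2l ?(ltW K0)//; lra.
    rewrite KN (@le_trans _ _ (2 * M + L1)) ?lerDr ?mulr_ge0 ?(ltW M0)//.
    by rewrite ler_peMr// ltW.
- move=> f [cf bf] t tT; have [st tT'] := andP tT.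
  have [B [-> B0 HB]] := supnorm_bounded bf.
  rewrite -EFinM; apply: grad_supnorm_le => x.
  have h0 : 0 < Num.sqrt (t - s) by rewrite sqrtr_gt0 subr_gt0.
  have h2 : Num.sqrt (t - s) ^+ 2 = t - s by rewrite sqr_sqrtr// subr_ge0 ltW.
  have hsT : Num.sqrt (t - s) <= Num.sqrt (T - s).
    by rewrite ler_sqrt ?subr_ge0 ?(ltW hT)// lerD2r.
  move: h0 h2 hsT; set h := Num.sqrt (t - s) => h0 h2 hsT.
  case: (evolG_cases Q b f st) => [->|[u solu ->]].
    by rewrite grad_cst enorm0 mulr_ge0// divr_ge0 ?(ltW h0)// divr_ge0 ?ltW.
  have hz : 0 < h * z by rewrite mulr_gt0.
  apply/ler_addgt0Pr => e e0.
  (* Again M is made positive at the cost of exactly e in the result 2 K del = (4 / z / h) M. *)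
  pose M := B + e / (4 / z / h).
  have zh0 : 0 < 4 / z / h by rewrite divr_gt0// divr_gt0.
  have M0 : 0 < M by rewrite ltr_wpDl// divr_gt0.
  have del_le : z * h <= N^-1.
    apply: (@le_trans _ _ (N^-1 / Num.sqrt (T - s) * h)).
      by rewrite ler_wpM2r ?(ltW h0)// ge_min lexx.
    by rewrite mulrAC ler_pdivrMr// ler_wpM2l// invr_ge0 ltW.
  have z2 : z ^+ 2 <= eta0.
    have zsq : z <= Num.sqrt eta0 by rewrite ge_min lexx orbT.
    rewrite -(sqr_sqrtr (ltW eta0_gt0)) ler_pXn2r ?nnegrE ?sqrtr_ge0//.
    exact: ltW.
  (* Chosen so that K del^2 = 2 M. Then c1 (t - s) = 2 M as well, which already bounds every
     increment of f. *)
  pose K := 2 * M / (z * h) ^+ 2.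
  have del0 : 0 < z * h by rewrite mulr_gt0.
  have K0 : 0 < K by rewrite divr_gt0 ?exprn_gt0// mulr_gt0.
  have Kdel2 : K * (z * h) ^+ 2 = 2 * M by rewrite divfK// gt_eqF// exprn_gt0.
  apply: (@le_trans _ _ (2 * K * (z * h))); last first.
    have -> : 2 * K * (z * h) = 4 / z / h * M.
      by rewrite /K; field; rewrite (gt_eqF z0) (gt_eqF h0).
    by rewrite /M mulrDr [_ * (e / _)]mulrC divfK// gt_eqF.
  have HM y : `|f y| <= M by rewrite (le_trans (HB y))// /M lerDl ltW// divr_gt0.
  have c1E : K * z ^+ 2 * (t - s) = 2 * M by rewrite -h2 -Kdel2; ring.
  apply: (key f u t (z * h) K (K * z ^+ 2) M solu tT) => //.
  - by rewrite Kdel2.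
  - by rewrite mulr_ge0 ?sqr_ge0// ltW.
  - rewrite [2 * K]mulrC -(mulrA K) (ltr_pM2l K0); lra.
  - move=> y w yw; rewrite c1E.
    have -> : 2 * K * (z * h) * enorm (y - w) - K * enorm (y - w) ^+ 2 =
      K * enorm (y - w) * (2 * (z * h) - enorm (y - w)) by ring.
    apply: (@le_trans _ _ (2 * M)).
      have := HM y; have := HM w; rewrite !ler_norml.
      by move=> /andP[? ?] /andP[? ?]; lra.
    rewrite lerDr; apply: mulr_ge0; last by lra.
    by apply: mulr_ge0; [exact: ltW|exact: enorm_ge0].
Qed.
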